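(* There exist constants $B_1,B_2$ depending on $q$ and $U$ only such that for any integer $m\ge9$, any $q\ge1$ and any probability density $f$ on $\mathbb R^d$ with $\|f\|_\infty\le\alpha_m^{-1}$, $$\mathbb E_f\Big\{\sup_{\vec h\in\mathcal H^d_m}\big(\mathcal U_{\vec h}-2U^*_{\vec h}(f)\big)_+^q\Big\}\le B_1[2\ln(m)]^{d/2}m^{-2q},$$ $$\mathbb E_f\Big\{\sup_{\vec h\in\mathcal H^d_m}\big(U^*_{\vec h}(f)-9\,\mathcal U_{\vec h}\big)_+^q\Big\}\le B_2[2\ln(m)]^{d/2}m^{-2q}.$$
   Context: $X_1,\dots,X_m,Y_1,\dots,Y_m$ ($d\ge1$) are i.i.d. random vectors in $\mathbb R^d$ with density $f$; $\mathbb E_f$ is expectation under their joint law; $(a)_+=\max(a,0)$; $\mathrm 1_A$ is the indicator of $A$; $x/\vec h$ is the coordinatewise quotient. $U:\mathbb R^d\to\mathbb R$ is a symmetric bounded function supported on a given cube $(-t,t)^d$, $t>0$; $\varpi_U=1\vee\sup_{p\in[1,\infty]}\|U\|_p$. For $\vec h\in(0,1]^d$: $V_{\vec h}=\prod_{j=1}^dh_j$, $U_{\vec h}(x)=V_{\vec h}^{-1}U(x/\vec h)$. $\alpha_m\downarrow0$ is an a priori chosen sequence with $\alpha_m\ln(m)\ge1$ and $\alpha_m\le1/3$ for the values of $m$ considered. $\mathfrak H^d=\{\vec h\in(0,1]^d:m^2V_{\vec h}\ge\ln(m)\}$; $\mathcal H^d_m=\mathfrak H^d\cap\{e^{-k}:k=1,\dots,2\lfloor\ln(m)\rfloor\}^d$;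 $H^d_m=\{\vec h\in\mathcal H^d_m:mV_{\vec h}<\ln(m)\}$, $\bar H^d_m=\mathcal H^d_m\setminus H^d_m$; $\mathfrak H^d_*=\{\vec h\in\mathfrak H^d:mV_{\vec h}\le\alpha_m^2\}$, $\bar{\mathfrak H}^d_*=\mathfrak H^d\setminus\mathfrak H^d_*$. For $\vec k\in\mathbb Z^d$, $\Pi^*_{\vec k}=\prod_{r=1}^d((k_r-1)t,(k_r+2)t]$. With $s=12q+2$: $$\Upsilon_{\vec h}(m)=10\ln(m)\,\mathrm 1_{\bar{\mathfrak H}^d_*}(\vec h)+\tfrac{17\ln(m)}{|\ln(mV_{\vec h})|}\mathrm 1_{\mathfrak H^d_*}(\vec h).$$ Deterministic quantities: $$J_{\vec h}(f)=\iint|U_{\vec h}(y-z)|f(y)f(z)\,dy\,dz,\qquad \mathcal W_{\vec h}(f)=V_{\vec h}^{-1}\Big[\tfrac{256s\ln(m)}m\vee\sup_{\vec k\in\mathbb Z^d}\int_{\mathbb R^d}\mathrm 1_{\Pi^*_{\vec k}}(y/\vec h)f(y)\,dy\Big],$$ $$W^*_{\vec h}(f)=\mathcal W_{\vec h}(f)\mathrm 1_{\bar H^d_m}(\vec h)+\alpha_m^{-1}\mathrm 1_{H^d_m}(\vec h),$$ $$U^*_{\vec h}(f)=\Big[\tfrac{16s\varpi_UW^*_{\vec h}(f)J_{\vec h}(f)\ln(m)}{m}\Big]^{1/2}+\Big[\tfrac{16s\varpi_UJ_{\vec h}(f)\ln(m)}{m^2V_{\vec h}}\Big]^{1/2}+\tfrac{147s\varpi_UW^*_{\vec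 h}(f)\ln(m)}{m}+\tfrac{\Upsilon_{\vec h}(m)s^2\varpi_U\ln(m)}{m^2V_{\vec h}}.$$ Random counterparts: $$\widehat J_{\vec h}=\tfrac1{m^2}\sum_{i,j=1}^m|U_{\vec h}(Y_i-X_j)|,\qquad \widehat{\mathcal W}_{\vec h}=\tfrac1{mV_{\vec h}}\Big[256s\ln(m)\vee\sup_{\vec k\in\mathbb Z^d}\sum_{j=1}^m\mathrm 1_{\Pi^*_{\vec k}}(X_j/\vec h)\Big],$$ $$\widehat W_{\vec h}=\widehat{\mathcal W}_{\vec h}\mathrm 1_{\bar H^d_m}(\vec h)+\alpha_m^{-1}\mathrm 1_{H^d_m}(\vec h),$$ $$\mathcal U_{\vec h}=\Big[\tfrac{16s\varpi_U\widehat W_{\vec h}\widehat J_{\vec h}\ln(m)}{m}\Big]^{1/2}+\Big[\tfrac{16s\varpi_U\widehat J_{\vec h}\ln(m)}{m^2V_{\vec h}}\Big]^{1/2}+\tfrac{147s\varpi_U\widehat W_{\vec h}\ln(m)}{m}+\tfrac{s^2\varpi_U\Upsilon_{\vec h}(m)\ln(m)}{m^2V_{\vec h}}.$$ *)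

(* Defs.v *)
(* R^d is [d.-tuple R]: the library equips it with the
   sigma-algebra generated by the coordinate maps, i.e. the Borel sets. *)
From HB Require Import structures.
From mathcomp Require Import all_boot all_order all_algebra.
From mathcomp Require Import all_classical all_reals all_analysis.

Set Implicit Arguments.
Unset Strict Implicit.
Unset Printing Implicit Defensive.

Import Order.TTheory GRing.Theory Num.Theory.
Import numFieldNormedType.Exports.

Local Open Scope classical_set_scope.
Local Open Scope ring_scope.

Section lebesgue_Rd.
Context (R : realType).

Definition vcons d (p : R * d.-tuple R) : d.+1.-tuple R :=
  [tuple of p.1 :: p.2].

Lemma measurable_vcons d : measurable_fun [set: R * d.-tuple R] (@vcons d).
Proof. exact: measurable_cons measurable_fst measurable_snd. Qed.

Section step.
Context d (mu : {measure set (d.-tuple R) -> \bar R}).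

Definition leb_step : set (d.+1.-tuple R) -> \bar R :=
  pushforward (lebesgue_measure \x^ mu)%E (@vcons d).

Let leb_step_measure : {measure set (d.+1.-tuple R) -> \bar R} :=
  measure_function_pushforward__canonical__measure_function_Measure
    (lebesgue_measure \x^ mu)%E (@measurable_vcons d).

HB.instance Definition _ := Measure.copy leb_step leb_step_measure.

End step.

(* Lebesgue measure on R^d, built one coordinate at a time. *)
Fixpoint leb d : {measure set (d.-tuple R) -> \bar R} :=
  match d with
  | 0 => @dirac _ _ [tuple] R
  | d'.+1 => leb_step (leb d')
  end.

Lemma measurable_box d (A : 'I_d -> set R) : (forall i, measurable (A i)) ->
  measurable [set x : d.-tuple R | forall i, A i (tnth x i)].
Proof.
move=> mA; rewrite (_ : mkset _ =
  \bigcap_(i in [set: 'I_d]) (fun x : d.-tuple R => tnth x i) @^-1` A i); last first.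
  by apply/seteqP; split=> [x h i _|x h i]; exact: h.
apply: (@fin_bigcap_measurable _ (d.-tuple R)); first exact: finite_finset.
move=> i _; by rewrite -[X in measurable X]setTI; exact: measurable_tnth.
Qed.

(* The characteristic property of [leb]. *)
Lemma leb_box d (A : 'I_d -> set R) : (forall i, measurable (A i)) ->
  leb d [set x | forall i, A i (tnth x i)] =
  (\prod_(i < d) lebesgue_measure (A i))%E.
Proof.
elim: d A => [|d IH] A mA.
  by rewrite big_ord0 /= diracE mem_set // => -[].
rewrite big_ord_recl -(IH (fun i => A (lift ord0 i))); last by move=> i.
rewrite /= /leb_step /pushforward -product_measure2E//; last first.
- by apply: (@measurable_box d (fun i => A (lift ord0 i))) => i.
- exact: mA.
congr (_ _); apply/seteqP; split=> -[a x] /=.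
  move=> h; split; first exact: (h ord0).
  by move=> i; move: (h (lift ord0 i)); rewrite tnthS.
move=> [ha hx] i; have [j ->|->] := unliftP ord0 i; last exact: ha.
by rewrite tnthS.
Qed.

End lebesgue_Rd.

Section vectors.
Context (R : realType) (d : nat).
Implicit Types (x y h : d.-tuple R).

Definition vopp x : d.-tuple R := [tuple - tnth x j | j < d].
Definition vsub x y : d.-tuple R := [tuple tnth x j - tnth y j | j < d].
Definition vdiv x h : d.-tuple R := [tuple tnth x j / tnth h j | j < d].
Definition vol h : R := \prod_(j < d) tnth h j.

End vectors.

Section sampling.
Context (R : realType).

Definition prob_density d (f : d.-tuple R -> R) :=
  [/\ measurable_fun setT f, (forall x, 0 <= f x)
    & (\int[leb R d]_x (f x)%:E = 1)%E].

Definition has_density d (d0 : measure_display) (Omega : measurableType d0)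
    (P : probability Omega R) (X : {RV P >-> d.-tuple R})
    (f : d.-tuple R -> R) :=
  forall A, measurable A ->
    distribution P X A = (\int[leb R d]_(x in A) (f x)%:E)%E.

Definition mutually_independent (d0 d1 : measure_display)
    (Omega : measurableType d0) (T : measurableType d1)
    (P : probability Omega R) (I : finType) (Z : I -> {RV P >-> T}) :=
  forall (J : {set I}) (B : I -> set T), (forall i, measurable (B i)) ->
    (P (\bigcap_(i in [set` J]) (Z i @^-1` B i)) =
     \prod_(i in J) P (Z i @^-1` B i))%E.

Definition two_samples (m : nat) (T : Type) (X Y : 'I_m -> T)
    (k : 'I_m + 'I_m) : T :=
  match k with inl i => X i | inr j => Y j end.

End sampling.

Section bandwidths.
Context (R : realType) (d m : nat).
(* [a] stands for the single value alpha_m. *)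
Context (a : R).

Definition bandwidths : set (d.-tuple R) :=
  [set h | (forall j, 0 < tnth h j <= 1) /\ ln m%:R <= m%:R ^+ 2 * vol h].

Definition grid : set (d.-tuple R) := bandwidths `&`
  [set h | forall j, exists k : nat,
     [/\ (1 <= k)%N, k%:Z <= 2 * Num.floor (ln (m%:R : R))
       & tnth h j = expR (- k%:R)]].

Definition grid_small := grid `&` [set h | m%:R * vol h < ln m%:R].
Definition grid_large := grid `\` grid_small.

Definition bandwidths_small :=
  bandwidths `&` [set h | m%:R * vol h <= a ^+ 2].
Definition bandwidths_large := bandwidths `\` bandwidths_small.

Definition Upsilon (h : d.-tuple R) : R :=
  10 * ln m%:R * \1_bandwidths_large h +
  17 * ln m%:R / `|ln (m%:R * vol h)| * \1_bandwidths_small h.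

End bandwidths.

Section majorants.
Context (R : realType) (d m : nat).
(* [a] stands for alpha_m and [t] for the half-side of the cube. *)
Context (a t q : R) (U : d.-tuple R -> R).

Local Notation s := (12 * q + 2).
Local Notation L := (ln m%:R).
Local Notation lambda := (leb R d).

Definition varpi : R :=
  fine (maxe 1 (ereal_sup
    [set 'N[lambda]_p[EFin \o U] | p in [set p : \bar R | 1 <= p]]))%E.

Definition rescaled (h x : d.-tuple R) : R := (vol h)^-1 * U (vdiv x h).

Definition cell (k : d.-tuple int) : set (d.-tuple R) :=
  [set x | forall r, ((tnth k r)%:~R - 1) * t < tnth x r
                     <= ((tnth k r)%:~R + 2) * t].

(* The common shape of the deterministic and of the empirical majorant, as a
   function of the values of W and J plugged in. *)
Definition majorant (h : d.-tuple R) (W J : R) : R :=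
  Num.sqrt (16 * s * varpi * W * J * L / m%:R)
  + Num.sqrt (16 * s * varpi * J * L / (m%:R ^+ 2 * vol h))
  + 147 * s * varpi * W * L / m%:R
  + Upsilon m a h * s ^+ 2 * varpi * L / (m%:R ^+ 2 * vol h).

(* W on the large bandwidths, 1 / alpha_m on the small ones. *)
Definition truncate (h : d.-tuple R) (W : R) : R :=
  W * \1_(grid_large m) h + a^-1 * \1_(grid_small m) h.

Section deterministic.
Context (f : d.-tuple R -> R).

Definition J_det (h : d.-tuple R) : R :=
  \int[lambda]_y (\int[lambda]_z (`|rescaled h (vsub y z)| * f y * f z)).

Definition calW_det (h : d.-tuple R) : R :=
  (vol h)^-1 * Num.max (256 * s * L / m%:R)
    (sup (range (fun k => \int[lambda]_y (\1_(cell k) (vdiv y h) * f y)))).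

Definition W_det (h : d.-tuple R) : R := truncate h (calW_det h).

Definition U_det (h : d.-tuple R) : R := majorant h (W_det h) (J_det h).

End deterministic.

Section empirical.
Context (x y : 'I_m -> d.-tuple R).

Definition J_emp (h : d.-tuple R) : R :=
  (m%:R ^+ 2)^-1 * \sum_(i < m) \sum_(j < m) `|rescaled h (vsub (y i) (x j))|.

Definition calW_emp (h : d.-tuple R) : R :=
  (m%:R * vol h)^-1 * Num.max (256 * s * L)
    (sup (range (fun k => \sum_(j < m) \1_(cell k) (vdiv (x j) h)))).

Definition W_emp (h : d.-tuple R) : R := truncate h (calW_emp h).

Definition U_emp (h : d.-tuple R) : R := majorant h (W_emp h) (J_emp h).

End empirical.

End majorants.

(* sup over the (finite) grid of (F h)_+ ^ q. The grid is empty when d is large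
   compared with ln m; the real [sup] is then 0, as is natural for a supremum
   of nonnegative quantities. *)
Definition sup_pos_pow (R : realType) (d m : nat) (q : R)
    (F : d.-tuple R -> R) : R :=
  sup [set Num.max (F h) 0 `^ q | h in grid m].

(* Main.v *)
Require Import Defs.
From HB Require Import structures.
From mathcomp Require Import all_boot all_order all_algebra.
From mathcomp Require Import all_classical all_reals all_analysis.
From mathcomp Require Import measurable_realfun ess_sup_inf.
From mathcomp Require Import ring lra zify.

(* Multiplied by m^2 V_h / varpi_U, both majorants become the same function
     4 sqrt(l w j) + 4 sqrt(l j) + 147 l w + D l,  l = s ln m, D = s Upsilon_h,
   of w = m V_h W and j = m^2 V_h J / varpi_U. It therefore suffices to find, for
   each bandwidth, an event of probability 1 - O(m^(2-s)) on which the empirical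
   values w' and j' satisfy
     w' <= 5/4 w,  w <= 5 w',  j' <= 9/4 j + 9 w l + D l,  j <= 4 j' + 8 w l + 2 D l.
   The counts in the cells are controlled by Chernoff bounds; the union over the
   infinitely many cells converges because each bound is proportional to the
   probability of the cell and the cells cover every point at most 3^d times.
   The double sum j' is controlled by conditioning on X: its row sums are truncated
   at a level that they exceed with probability at most e^(1-l) -- in the very small
   bandwidth regime this level is of order l / |ln(m V_h)|, whence Upsilon_h -- and a
   Chernoff bound is applied first to Y given X, then to X.
   Off the good event the majorants are at most C m^4, and the grid has at most
   (2 ln m)^d <= 2^d d! m points, so that the expectations are of order
   m^(1 + 4q + 2 - s) <= m^(-2q). *)

Set Implicit Arguments.
Unset Strict Implicit.
Unset Printing Implicit Defensive.

Import Order.TTheory GRing.Theory Num.Theory.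
Import numFieldNormedType.Exports.

Local Open Scope classical_set_scope.
Local Open Scope ring_scope.

(** * Product measures on tuples *)

(** The obstacle is the conditional range of the row sums: bounding them for all possible values of
    a point of [Y] would mean a supremum over an uncountable family. A tail bound at each fixed
    value is enough here. Taking the minimum with a cutoff makes the row sum bounded everywhere, and
    the pointwise bound is then integrated with Fubini twice: at the [m] actual points of [Y], where
    the cutoff turns out to be inactive, and in the conditional mean, where the loss is controlled
    by Markov's inequality. The kernel is bounded by [varpi U] only almost everywhere. It is
    therefore truncated as well, and the pairs of points with a larger value form a null event. The
    half-side [t] enters only through the finiteness of the norms and through the overlap of the
    cells, which is at most 3^d whatever [t] is. This is why the final constants can be chosen
    before [t]. *)

Definition box n T (A : 'I_n -> set T) : set (n.-tuple T) :=
  [set x | forall i, A i (tnth x i)].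

Lemma measurable_tuple_box d (T : measurableType d) n (A : 'I_n -> set T) :
  (forall i, measurable (A i)) -> measurable (box A).
Proof.
move=> mA; rewrite (_ : box A =
  \bigcap_(i in [set: 'I_n]) (fun x : n.-tuple T => tnth x i) @^-1` A i); last first.
  by apply/seteqP; split=> [x h i _|x h i]; exact: h.
apply: (@fin_bigcap_measurable _ (n.-tuple T)); first exact: finite_finset.
move=> i _; by rewrite -[X in measurable X]setTI; exact: measurable_tnth.
Qed.

(** Boxes are stable under intersection and generate the product sigma-algebra; the sequence [g]
    supplies the exhaustion by boxes of finite measure. *)
Lemma tuple_measure_unique d (T : measurableType d) (R : realType) n
    (g : nat -> set T) (m1 m2 : {measure set (n.-tuple T) -> \bar R}) :
  (forall k, measurable (g k)) ->
  nondecreasing_seq g -> \bigcup_k g k = setT ->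
  (forall A, (forall i, measurable (A i)) -> m1 (box A) = m2 (box A)) ->
  (forall k, (m1 (box (fun=> g k)) < +oo)%E) ->
  forall E, measurable E -> m1 E = m2 E.
Proof.
move=> mg ndg Ug m12 g_oo.
pose G : set (set (n.-tuple T)) :=
  [set B | exists2 A : 'I_n -> set T, (forall i, measurable (A i)) & B = box A].
apply: (measure_unique G (fun k => box (fun=> g k))) => //.
- apply/seteqP; split.
  + apply: smallest_sub; first exact: smallest_sigma_algebra.
    case: n => [|n] in m1 m2 m12 g_oo G *; first by rewrite big_ord0.
    rewrite -bigcup_mkord_ord; apply: bigcup_sub => i Ii A [B mB <-].
    apply: sub_sigma_algebra; exists (fun j => if j == inord i then B else setT).
      by move=> j; case: ifP => // _; exact: mB.
    apply/seteqP; split => x /=.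
      by move=> [_ Bx] j; case: eqP => // ->.
    by move=> /(_ (inord i)); rewrite eqxx.
  + apply: smallest_sub; first exact: sigma_algebra_measurable.
    by move=> _ [A mA ->]; exact: measurable_tuple_box.
- move=> _ _ [A mA ->] [B mB ->]; exists (fun i => A i `&` B i).
    by move=> i; exact: measurableI.
  apply/seteqP; split => x /=; first by move=> [a b] i; split; [exact: a|exact: b].
  by move=> ab; split=> i; have [] := ab i.
- by move=> k; exists (fun=> g k).
- apply/seteqP; split=> // x _.
  have h (i : 'I_n) : exists k, g k (tnth x i).
    have : (\bigcup_k g k) (tnth x i) by rewrite Ug.
    by move=> [k _ ?]; exists k.
  have [f hf] := choice h.
  (* There are finitely many coordinates, so one index of the monotone sequence serves them all. *)
  exists (\max_i f i)%N => // i /=.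
  by have /subsetPset := ndg _ _ (leq_bigmax (F := f) i); apply; exact: hf.
- by move=> _ [A mA ->]; exact: m12.
Qed.

Section power_measure.
Context d (T : measurableType d) (R : realType) (mu : probability T R).

Definition tcons n (p : T * n.-tuple T) : n.+1.-tuple T := [tuple of p.1 :: p.2].

Lemma measurable_tcons n : measurable_fun [set: T * n.-tuple T] (@tcons n).
Proof. exact: measurable_cons measurable_fst measurable_snd. Qed.

HB.instance Definition _ n :=
  isMeasurableFun.Build _ _ _ _ (@tcons n) (@measurable_tcons n).

(** The law of [n] independent draws from [mu], built one coordinate at a time so that integrals of
    products factor by induction with Tonelli's theorem. *)
Fixpoint pw n : probability (n.-tuple T) R :=
  match n with
  | 0 => @dirac _ _ [tuple] R
  | n'.+1 => distribution (mu \x pw n')%E (@tcons n')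
  end.

Lemma integral_pw_prod n (g : 'I_n -> T -> R) :
  (forall i, measurable_fun setT (g i)) -> (forall i x, 0 <= g i x) ->
  (\int[pw n]_x (\prod_(i < n) g i (tnth x i))%:E =
   \prod_(i < n) \int[mu]_x (g i x)%:E)%E.
Proof.
have mp k (h : 'I_k -> T -> R) : (forall i, measurable_fun setT (h i)) ->
    measurable_fun [set: k.-tuple T] (fun x => \prod_(i < k) h i (tnth x i)).
  move=> mh; apply: measurable_prod => i _.
  by apply: measurableT_comp => //; exact: measurable_tnth.
elim: n g => [|n IH] g mg g0.
  under eq_integral do rewrite big_ord0.
  by rewrite big_ord0 integral_cst// mul1e [LHS]diracE mem_set.
rewrite /= ge0_integral_distribution//; last 2 first.
- by apply/measurable_EFinP; exact: mp.
- by move=> y; rewrite lee_fin prodr_ge0.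
rewrite fubini_tonelli1//=; last 2 first.
- apply: measurableT_comp; last exact: measurable_tcons.
  by apply/measurable_EFinP; exact: mp.
- by move=> x; rewrite lee_fin prodr_ge0.
rewrite big_ord_recl -(IH (fun i => g (lift ord0 i)))//.
transitivity (\int[mu]_x ((g ord0 x)%:E *
    \int[pw n]_y (\prod_(i < n) g (lift ord0 i) (tnth y i))%:E))%E.
  apply: eq_integral => x _; rewrite /fubini_F -ge0_integralZl_EFin//.
  - apply: eq_integral => y _ /=; rewrite big_ord_recl EFinM.
    by congr (_ * _%:E)%E; apply: eq_bigr => i _; rewrite /tcons tnthS.
  - by move=> y _; rewrite lee_fin prodr_ge0.
  - by apply/measurable_EFinP; apply: (mp _ (fun i => g (lift ord0 i))).
rewrite ge0_integralZr//.
- by apply/measurable_EFinP; apply: mg.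
- by move=> x _; rewrite lee_fin.
- by apply: integral_ge0 => y _; rewrite lee_fin prodr_ge0.
Qed.

Lemma pw_box n (A : 'I_n -> set T) : (forall i, measurable (A i)) ->
  (pw n (box A) = \prod_(i < n) mu (A i))%E.
Proof.
move=> mA.
transitivity (\int[pw n]_x (\prod_(i < n) \1_(A i) (tnth x i))%:E)%E.
  rewrite -[in LHS](setIT (box A)) -integral_indic//; last exact: measurable_tuple_box.
  apply: eq_integral => x _; congr (_%:E).
  rewrite indicE; have [/set_mem bx|bx] := boolP (x \in box A).
    by rewrite big1// => i _; rewrite indicE mem_set.
  have [i /negP xi] : exists i, ~~ (tnth x i \in A i).
    apply: contrapT => /forallNP h; move/negP: bx; apply; apply/mem_set => i.
    by have /negP/negPn/set_mem := h i.
  rewrite (bigD1 i)//= indicE; case: (_ \in _) xi => //= _; by rewrite mul0r.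
rewrite (@integral_pw_prod _ (fun i => \1_(A i)))//.
by apply: eq_bigr => i _; rewrite integral_indic// setIT.
Qed.

End power_measure.

(** * Joint law of the two samples *)

Section sample_law.
Context d (T : measurableType d) (R : realType) (mu : probability T R).
Context d0 (Omega : measurableType d0) (P : probability Omega R) (n : nat).

Definition sample (X : 'I_n -> {RV P >-> T}) (w : Omega) : n.-tuple T :=
  [tuple X i w | i < n].

Lemma measurable_sample X : measurable_fun setT (sample X).
Proof.
apply/measurable_fun_tnthP => i; rewrite (_ : _ \o _ = X i)//.
by apply/funext => w /=; rewrite tnth_mktuple.
Qed.

HB.instance Definition _ X :=
  isMeasurableFun.Build _ _ _ _ (sample X) (measurable_sample X).

Definition sample2 (X Y : 'I_n -> {RV P >-> T}) (w : Omega) := (sample X w, sample Y w).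

Lemma measurable_sample2 X Y : measurable_fun setT (sample2 X Y).
Proof. by apply: measurable_fun_pair; exact: measurable_sample. Qed.

HB.instance Definition _ X Y :=
  isMeasurableFun.Build _ _ _ _ (sample2 X Y) (measurable_sample2 X Y).

(** Independence gives the equality on products of boxes only. It is extended one sample at a time:
    with the box of [X] fixed, both sides are finite measures in the event on [Y] and agree on
    boxes, hence everywhere; then the event on [Y] is fixed and the one on [X] varies. *)
Lemma law_sample2 (X Y : 'I_n -> {RV P >-> T}) :
  (forall i A, measurable A -> P (X i @^-1` A) = mu A) ->
  (forall i A, measurable A -> P (Y i @^-1` A) = mu A) ->
  mutually_independent (two_samples X Y) ->
  forall B, measurable B -> P (sample2 X Y @^-1` B) = (pw mu n \x pw mu n)%E B.
Proof.
move=> Xmu Ymu XYind.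
have boxes A B : (forall i, measurable (A i)) -> (forall i, measurable (B i)) ->
    P (sample X @^-1` box A `&` sample Y @^-1` box B) =
    (pw mu n (box A) * pw mu n (box B))%E.
  move=> mA mB; rewrite !pw_box//.
  pose C (k : 'I_n + 'I_n) := match k with inl i => A i | inr i => B i end.
  have mC k : measurable (C k) by case: k.
  have := XYind (finset.setTfor ('I_n + 'I_n)%type) C mC.
  rewrite (eq_bigl xpredT); last by move=> k; rewrite finset.in_setT.
  rewrite big_sumType/= => h.
  rewrite (eq_bigr (fun i => P (X i @^-1` A i))); last by move=> i _; rewrite Xmu.
  rewrite [X in (_ * X)%E](eq_bigr (fun i => P (Y i @^-1` B i))); last by move=> i _; rewrite Ymu.
  rewrite -h; congr (P _); apply/seteqP; split => w /=.
    by move=> [hA hB] [i|i] _ /=; [have := hA i|have := hB i]; rewrite tnth_mktuple.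
  by move=> hw; split=> i; rewrite tnth_mktuple; [apply: (hw (inl i))|apply: (hw (inr i))];
    rewrite /= finset.in_setT.
have ext (m1 m2 : {measure set (n.-tuple T) -> \bar R}) : (m1 setT < +oo)%E ->
    (forall A, (forall i, measurable (A i)) -> m1 (box A) = m2 (box A)) ->
    forall E, measurable E -> m1 E = m2 E.
  move=> m1oo m12; apply: (@tuple_measure_unique _ _ _ _ (fun _ : nat => [set: T]) m1 m2) => //.
  - by rewrite bigcup_const.
  - move=> k; apply: le_lt_trans m1oo; apply: le_measure; rewrite ?inE//.
    exact: measurable_tuple_box.
have mS := measurable_sample.
have mpre Z E : measurable E -> measurable (sample Z @^-1` E).
  by move=> mE; rewrite -[X in measurable X]setTI; exact: mS.
have fin (E : set Omega) : measurable E -> P E \is a fin_num by move=> ?; rewrite fin_num_measure.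
have half A E : (forall i, measurable (A i)) -> measurable E ->
    P (sample X @^-1` box A `&` sample Y @^-1` E) = (pw mu n (box A) * pw mu n E)%E.
  move=> mA mE.
  pose c : {nonneg R} := NngNum (fine_ge0 (measure_ge0 (pw mu n) (box A))).
  have mBA := mpre X _ (measurable_tuple_box mA).
  have cE : (c%:num)%:E = pw mu n (box A).
    by rewrite /= fineK// fin_num_measure//; exact: measurable_tuple_box.
  have : pushforward (mrestr P mBA) (sample Y) E = mscale c (pw mu n) E.
    apply: (ext (pushforward (mrestr P mBA) (sample Y)) (mscale c (pw mu n))) => //.
    - by rewrite -ge0_fin_numE ?measure_ge0//; apply: fin; apply: measurableI => //; apply: mpre.
    - by move=> B mB; have := boxes A B mA mB; rewrite setIC -cE.
  by rewrite /pushforward /mrestr /mscale cE setIC.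
have full E F : measurable E -> measurable F ->
    P (sample X @^-1` E `&` sample Y @^-1` F) = (pw mu n E * pw mu n F)%E.
  move=> mE mF.
  pose c : {nonneg R} := NngNum (fine_ge0 (measure_ge0 (pw mu n) F)).
  have mBF := mpre Y _ mF.
  have cE : (c%:num)%:E = pw mu n F by rewrite /= fineK// fin_num_measure.
  have : pushforward (mrestr P mBF) (sample X) E = mscale c (pw mu n) E.
    apply: (ext (pushforward (mrestr P mBF) (sample X)) (mscale c (pw mu n))) => //.
    - by rewrite -ge0_fin_numE ?measure_ge0//; apply: fin; apply: measurableI => //; apply: mpre.
    - by move=> B mB; have := half B F mB mF; rewrite muleC -cE.
  by rewrite /pushforward /mrestr /mscale cE muleC.
move=> B mB; rewrite (product_measure_unique (m' := distribution P (sample2 X Y)))//.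
Qed.

End sample_law.

(** * Chernoff bounds *)

Section real_valued.
Context d (T : measurableType d) (R : realType).
Implicit Types (f g : T -> R).

Lemma measurable_ge_fun f g : measurable_fun setT f -> measurable_fun setT g ->
  measurable [set x | f x <= g x].
Proof.
move=> mf mg; rewrite -[X in measurable X]setTI.
by have := measurable_fun_ler mf mg measurableT (_ : measurable [set true]); rewrite /preimage; apply.
Qed.

Lemma measurable_gt_fun f g : measurable_fun setT f -> measurable_fun setT g ->
  measurable [set x | f x < g x].
Proof.
move=> mf mg; rewrite -[X in measurable X]setTI.
by have := measurable_fun_ltr mf mg measurableT (_ : measurable [set true]); rewrite /preimage; apply.
Qed.

Lemma markov_ge0 (mu : {measure set T -> \bar R}) f (c : R) :
  measurable_fun setT f -> (forall x, 0 <= f x) -> 0 <= c ->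
  (c%:E * mu [set x | (c <= f x)%R] <= \int[mu]_x (f x)%:E)%E.
Proof.
move=> mf f0 c0.
have mA : measurable [set x | c <= f x] by apply: measurable_ge_fun.
rewrite -[X in mu X]setIT -integral_indic// -ge0_integralZl_EFin//; last first.
  exact/measurable_EFinP.
apply: ge0_le_integral => //.
- by move=> x _; rewrite mule_ge0// lee_fin.
- by apply/measurable_EFinP; apply: measurable_funM.
- exact/measurable_EFinP.
- move=> x _; rewrite -EFinM lee_fin indicE.
  have [/set_mem/= cx|_] := boolP (x \in _); first by rewrite mulr1.
  by rewrite mulr0.
Qed.

End real_valued.

Section exponential_bounds.
Context (R : realType).
Implicit Types (x g lam : R).

(** Convexity of the exponential between 0 and [lam]. The tangent at [lam * g] bounds both end
    values from below; weighting the two bounds by [1 - g] and [g] cancels the slope. *)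
Lemma expR_chord lam g : 0 <= g <= 1 ->
  expR (lam * g) <= (1 - g) + g * expR lam.
Proof.
move=> /andP[g0 g1].
have hA : expR (lam * g) * (1 - lam * g) <= 1.
  rewrite -[leRHS](expRxMexpNx_1 (lam * g)) ler_wpM2l ?expR_ge0//.
  exact: expR_ge1Dx.
have hB : expR (lam * g) * (1 + (lam - lam * g)) <= expR lam.
  have -> : expR lam = expR (lam * g) * expR (lam - lam * g).
    by rewrite -expRD; congr expR; ring.
  by rewrite ler_wpM2l ?expR_ge0// expR_ge1Dx.
have := lerD (ler_wpM2l (_ : 0 <= 1 - g) hA) (ler_wpM2l g0 hB).
rewrite subr_ge0 => /(_ g1); rewrite mulr1; apply: le_trans.
lra.
Qed.

Lemma expR_le_inv x : x < 1 -> expR x <= (1 - x)^-1.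
Proof.
move=> x1; rewrite -[x in expR x]opprK expRN lef_pV2 ?posrE ?expR_gt0 ?subr_gt0//.
exact: expR_ge1Dx.
Qed.

Lemma expRB1_le x : expR x - 1 <= x * expR x.
Proof.
have := ler_wpM2l (expR_ge0 x) (expR_ge1Dx (- x)).
rewrite expRxMexpNx_1; lra.
Qed.

End exponential_bounds.

Section chernoff.
Context d (T : measurableType d) (R : realType) (mu : probability T R).
Variables (n : nat) (g : T -> R) (p : R).
Hypothesis mg : measurable_fun setT g.
Hypothesis intg : (\int[mu]_x (g x)%:E = p%:E)%E.

Local Notation S x := (\sum_(i < n) g (tnth x i)).

Lemma measurable_tuple_sum : measurable_fun [set: n.-tuple T] (fun x => S x).
Proof.
apply: measurable_sum => i; apply: measurableT_comp => //.
exact: measurable_tnth.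
Qed.

(** By the chord bound [g] does no worse than a Bernoulli variable of mean [p], whose transform
    [1 - p + p * expR lam] is at most [expR ((expR lam - 1) * p)]. *)
Lemma integral_mgf (g01 : forall x, 0 <= g x <= 1) lam :
  (\int[pw mu n]_x (expR (lam * S x))%:E <= (expR (n%:R * ((expR lam - 1) * p)))%:E)%E.
Proof.
under eq_integral do rewrite mulr_sumr expR_sum.
rewrite (@integral_pw_prod _ _ _ _ _ (fun=> expR \o (fun x => lam * g x)))//=; last first.
  by move=> _; apply: measurableT_comp => //; apply: measurable_funM.
have h : (\int[mu]_x (expR (lam * g x))%:E <= (expR ((expR lam - 1) * p))%:E)%E.
  apply: (@le_trans _ _ (\int[mu]_x ((1 - g x)%:E + (expR lam)%:E * (g x)%:E))%E).
    apply: ge0_le_integral => //.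
    - by apply/measurable_EFinP; apply: measurableT_comp => //; apply: measurable_funM.
    - apply: emeasurable_funD; first by apply/measurable_EFinP; apply: measurable_funB.
      by apply: emeasurable_funM => //; apply/measurable_EFinP.
    - by move=> x _; rewrite -EFinM -EFinD lee_fin [expR lam * _]mulrC expR_chord.
  (* Read off from additivity, which involves nonnegative integrands only. *)
  have p1 : (\int[mu]_x (1 - g x)%:E = (1 - p)%:E)%E.
    have : (\int[mu]_x ((1 - g x)%:E + (g x)%:E) = 1)%E.
      under eq_integral do rewrite -EFinD subrK.
      by rewrite integral_cst//= probability_setT mul1e.
    rewrite ge0_integralD//; last 4 first.
    - by move=> x _; have /andP[_] := g01 x; rewrite lee_fin subr_ge0.
    - by apply/measurable_EFinP; apply: measurable_funB.
    - by move=> x _; have /andP[] := g01 x; rewrite lee_fin.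
    - exact/measurable_EFinP.
    rewrite intg; case: (\int[mu]_x (1 - g x)%:E)%E => //= r.
    by rewrite -EFinD => -[<-]; rewrite addrK.
  rewrite ge0_integralD//; last 4 first.
  - by move=> x _; have /andP[_] := g01 x; rewrite lee_fin subr_ge0.
  - by apply/measurable_EFinP; apply: measurable_funB.
  - by move=> x _; have /andP[? _] := g01 x; rewrite -EFinM lee_fin mulr_ge0// expR_ge0.
  - by apply: emeasurable_funM => //; apply/measurable_EFinP.
  rewrite ge0_integralZl_EFin//; last 2 first.
  - by move=> x _; have /andP[? _] := g01 x; rewrite lee_fin.
  - exact/measurable_EFinP.
  rewrite p1 intg -EFinM -EFinD lee_fin (le_trans _ (expR_ge1Dx _))//.
  lra.
have h0 : (0 <= \int[mu]_x (expR (lam * g x))%:E)%E.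
  by apply: integral_ge0 => x _; rewrite lee_fin expR_ge0.
rewrite mulr_natl; elim: (n) => [|k IH]; first by rewrite big_ord0 mulr0n expR0.
by rewrite big_ord_recl mulrS expRD EFinM lee_pmul// prode_ge0.
Qed.

(** The sign of [lam] is free: positive values give the upper tail, negative ones the lower tail. *)
Lemma chernoff_unit (g01 : forall x, 0 <= g x <= 1) lam a :
  (pw mu n [set x | a <= lam * S x]%R <= (expR (n%:R * ((expR lam - 1) * p) - a))%:E)%E.
Proof.
have mS := measurable_tuple_sum.
have mE : measurable_fun [set: n.-tuple T] (fun x => expR (lam * S x)).
  by apply: measurableT_comp => //; apply: measurable_funM.
have := markov_ge0 (pw mu n) mE (fun x => expR_ge0 _) (expR_ge0 a).
rewrite (_ : [set x | expR a <= expR (lam * S x)] = [set x | a <= lam * S x]); last first.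
  by apply/seteqP; split=> x /=; rewrite ler_expR.
move=> /le_trans/(_ (integral_mgf g01 lam)).
rewrite expRD expRN -lee_pdivlMl ?expR_gt0// -EFinM mulrC//.
Qed.

End chernoff.

Section chernoff_bounded.
Context d (T : measurableType d) (R : realType) (mu : probability T R).
Variables (n : nat) (g : T -> R) (p M : R).
Hypothesis mg : measurable_fun setT g.
Hypothesis intg : (\int[mu]_x (g x)%:E = p%:E)%E.
Hypothesis M0 : 0 < M.
Hypothesis gM : forall x, 0 <= g x <= M.

Local Notation S x := (\sum_(i < n) g (tnth x i)).

Let gM01 x : 0 <= g x / M <= 1.
Proof. by have /andP[g0 g1] := gM x; rewrite divr_ge0 ?(ltW M0)//= ler_pdivrMr// mul1r. Qed.

Let mgM : measurable_fun setT (fun x => g x / M).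
Proof. exact: measurable_funM. Qed.

Let intgM : (\int[mu]_x (g x / M)%:E = (p / M)%:E)%E.
Proof.
under eq_integral do rewrite mulrC EFinM.
rewrite ge0_integralZl_EFin// ?intg -?EFinM 1?mulrC//.
- by move=> x _; have /andP[] := gM x; rewrite lee_fin.
- exact/measurable_EFinP.
- by rewrite invr_ge0 ltW.
Qed.

Let sumE (x : n.-tuple T) : \sum_(i < n) g (tnth x i) / M = S x / M.
Proof. by rewrite mulr_suml. Qed.

(** Taken at [lam = 1/3]: since e^(1/3) <= 3/2, the transform contributes at most half of the
    normalized mean, which is what the threshold with factor 3/2 removes. *)
Lemma chernoff_above x0 :
  (pw mu n [set x | (3 / 2 * (n%:R * p) + 3 * M * x0 <= S x)%R] <= (expR (- x0))%:E)%E.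
Proof.
set a := (3^-1 * (3 / 2 * (n%:R * p) / M + 3 * x0) : R).
have := chernoff_unit n mgM intgM gM01 3^-1 a.
under [in X in (X <= _)%E -> _]eq_set do rewrite sumE.
rewrite (_ : [set x | a <= _] = [set x | 3 / 2 * (n%:R * p) + 3 * M * x0 <= S x]); last first.
  have aE s : (a <= 3^-1 * (s / M)) = (3 / 2 * (n%:R * p) + 3 * M * x0 <= s).
    rewrite /a ler_pM2l ?invr_gt0// ler_pdivlMr//; congr (_ <= _); field.
    by rewrite gt_eqF.
  by apply/seteqP; split=> x /=; rewrite aE.
move=> /le_trans; apply; rewrite lee_fin ler_expR /a.
have e : expR (3^-1 : R) <= 3/2.
  have := @expR_le_inv R 3^-1; rewrite (_ : (1 - 3^-1)^-1 = 3/2 :> R); last by field.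
  by apply; lra.
have p0 : 0 <= n%:R * (p / M).
  rewrite mulr_ge0// divr_ge0 ?(ltW M0)// -lee_fin -intg.
  by apply: integral_ge0 => x _; have /andP[] := gM x; rewrite lee_fin.
have := ler_wpM2l p0 e.
rewrite (_ : 3 / 2 * (n%:R * p) / M = 3/2 * (n%:R * (p / M))); last by ring.
rewrite (_ : n%:R * ((expR 3^-1 - 1) * (p / M)) = (expR 3^-1 - 1) * (n%:R * (p / M))); last by ring.
lra.
Qed.

(** Taken at [lam = -1], with e^(-1) <= 1/2. *)
Lemma chernoff_below x0 :
  (pw mu n [set x | (S x <= 1 / 2 * (n%:R * p) - M * x0)%R] <= (expR (- x0))%:E)%E.
Proof.
set a := (- (1 / 2 * (n%:R * p) / M - x0) : R).
have := chernoff_unit n mgM intgM gM01 (-1) a.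
under [in X in (X <= _)%E -> _]eq_set do rewrite sumE.
rewrite (_ : [set x | a <= _] = [set x | S x <= 1 / 2 * (n%:R * p) - M * x0]); last first.
  have aE s : (a <= -1 * (s / M)) = (s <= 1 / 2 * (n%:R * p) - M * x0).
    rewrite /a mulN1r lerN2 ler_pdivrMr//; congr (_ <= _); field.
    by rewrite gt_eqF.
  by apply/seteqP; split=> x /=; rewrite aE.
move=> /le_trans; apply; rewrite lee_fin ler_expR /a.
have e : expR (- 1 : R) <= 1/2.
  by rewrite expRN -[1/2]invrK lef_pV2 ?posrE ?expR_gt0//; have := @expR_ge1Dx R 1; lra.
have p0 : 0 <= n%:R * (p / M).
  rewrite mulr_ge0// divr_ge0 ?(ltW M0)// -lee_fin -intg.
  by apply: integral_ge0 => x _; have /andP[] := gM x; rewrite lee_fin.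
have := ler_wpM2l p0 e.
rewrite (_ : 1 / 2 * (n%:R * p) / M = 1/2 * (n%:R * (p / M))); last by ring.
rewrite (_ : n%:R * ((expR (-1) - 1) * (p / M)) = (expR (-1) - 1) * (n%:R * (p / M))); last by ring.
lra.
Qed.

End chernoff_bounded.

(** * Decoupled double sums *)

Section union_bounds.
Context d (T : measurableType d) (R : realType) (P : probability T R).

Lemma measurable_exists_in (I : eqType) (s : seq I) (A : I -> set T) :
  (forall i, measurable (A i)) -> measurable [set x | exists2 i, i \in s & A i x].
Proof.
move=> mA; elim: s => [|i s IH].
  rewrite (_ : [set _ | _] = set0)//; by apply/seteqP; split=> x // -[].
rewrite (_ : [set _ | _] = A i `|` [set x | exists2 i, i \in s & A i x]); first exact: measurableU.
apply/seteqP; split => x /=.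
  by move=> [j]; rewrite inE => /orP[/eqP ->|js]; [left|right; exists j].
by move=> [ix|[j js jx]]; [exists i; rewrite ?mem_head|exists j; rewrite // inE js orbT].
Qed.

Lemma measure_exists_in_le (I : eqType) (s : seq I) (A : I -> set T) (c : R) :
  (forall i, measurable (A i)) -> (forall i, i \in s -> (P (A i) <= c%:E)%E) ->
  (P [set x | exists2 i, i \in s & A i x] <= ((size s)%:R * c)%:E)%E.
Proof.
move=> mA; elim: s => [|i s IH] h.
  rewrite (_ : [set _ | _] = set0) ?measure0 ?mul0r//; by apply/seteqP; split=> x // -[].
rewrite (_ : [set _ | _] = A i `|` [set x | exists2 i, i \in s & A i x]); last first.
  apply/seteqP; split => x /=.
    by move=> [j]; rewrite inE => /orP[/eqP ->|js]; [left|right; exists j].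
  by move=> [ix|[j js jx]]; [exists i; rewrite ?mem_head|exists j; rewrite // inE js orbT].
apply: (le_trans (measureU2 _ (mA i) (measurable_exists_in _ mA))).
rewrite /= -natr1 mulrDl mul1r addrC EFinD leeD ?h ?mem_head//.
by apply: IH => j js; apply: h; rewrite inE js orbT.
Qed.

End union_bounds.

Section product_bounds.
Context d1 d2 (T1 : measurableType d1) (T2 : measurableType d2) (R : realType).
Variables (P1 : probability T1 R) (P2 : probability T2 R).

Lemma integral_le_cst d (T : measurableType d) (P : probability T R) (h : T -> \bar R) (c : \bar R) :
  measurable_fun setT h -> (forall x, (0 <= h x)%E) -> (forall x, (h x <= c)%E) ->
  (\int[P]_x h x <= c)%E.
Proof.
move=> mh h0 hc; apply: (@le_trans _ _ (\int[P]_x cst c x)%E).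
  by apply: ge0_le_integral.
by rewrite integral_cst//= probability_setT mule1.
Qed.

Lemma product_measure_le_xsection (B : set (T1 * T2)) c : measurable B ->
  (forall x, (P2 [set y | B (x, y)] <= c)%E) -> ((P1 \x P2) B <= c)%E.
Proof.
move=> mB h; apply: integral_le_cst => //; first exact: measurable_fun_xsection.
move=> x /=; rewrite (_ : xsection B x = [set y | B (x, y)])//.
by apply/seteqP; split=> y; rewrite /xsection /= inE.
Qed.

Lemma product_measure_le_ysection (B : set (T1 * T2)) c : measurable B ->
  (forall y, (P1 [set x | B (x, y)] <= c)%E) -> ((P1 \x P2) B <= c)%E.
Proof.
move=> mB h.
rewrite (@product_measure_unique _ _ _ _ _ P1 P2 (P1 \x^ P2)%E)//; last first.
  exact: product_measure2E.
apply: integral_le_cst => //; first exact: measurable_fun_ysection.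
move=> y /=; rewrite (_ : ysection B y = [set x | B (x, y)])//.
by apply/seteqP; split=> x; rewrite /ysection /= inE.
Qed.

Lemma product_measure_fst (B : set T1) : measurable B ->
  ((P1 \x P2) [set z | B z.1] = P1 B)%E.
Proof.
move=> mB; rewrite (_ : [set z | B z.1] = B `*` setT).
  by rewrite [LHS]product_measure1E// [X in (_ * X)%E]probability_setT mule1.
by apply/seteqP; split=> -[x y] //= [].
Qed.

Context (h : T1 * T2 -> R).
Hypotheses (mh : measurable_fun setT h) (h0 : forall z, 0 <= h z).

Lemma measurable_section1 x : measurable_fun setT (fun y => h (x, y)).
Proof. exact: (measurableT_comp mh (pair1_measurable x)). Qed.

Lemma measurable_section2 y : measurable_fun setT (fun x => h (x, y)).
Proof. exact: (measurableT_comp mh (pair2_measurable y)). Qed.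

Lemma measurable_integral_snd : measurable_fun setT (fun x => \int[P2]_y (h (x, y))%:E)%E.
Proof.
apply: (measurable_fun_fubini_tonelli_F (m2 := P2) (EFin \o h)) => /=.
  exact/measurable_EFinP.
by move=> z; rewrite lee_fin.
Qed.

Lemma measurable_integral_fst : measurable_fun setT (fun y => \int[P1]_x (h (x, y))%:E)%E.
Proof.
apply: (measurable_fun_fubini_tonelli_G (m1 := P1) (EFin \o h)) => /=.
  exact/measurable_EFinP.
by move=> z; rewrite lee_fin.
Qed.

Lemma integral_swap : (\int[P1]_x \int[P2]_y (h (x, y))%:E =
  \int[P2]_y \int[P1]_x (h (x, y))%:E)%E.
Proof.
apply: (@fubini_tonelli _ _ _ _ _ P1 P2 (EFin \o h)) => /=.
  exact/measurable_EFinP.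
by move=> z; rewrite lee_fin.
Qed.

End product_bounds.

(* Conditionally on [x] the statistic is a sum over [y] of independent terms, which
   are bounded by [M] once the row sums are truncated at [M]. *)
Section decoupled_statistic.
Context d (T : measurableType d) (R : realType) (mu : probability T R).
Variables (n : nat) (phi : T * T -> R) (omega M J l delta : R).
Hypothesis n0 : (0 < n)%N.
Hypothesis mphi : measurable_fun setT phi.
Hypothesis phi01 : forall z, 0 <= phi z <= 1.
Hypothesis omega0 : 0 < omega.
Hypothesis M0 : 0 < M.
Hypothesis phi_r : forall x, (\int[mu]_u (phi (u, x))%:E <= omega%:E)%E.
Hypothesis intphi : (\int[mu]_u \int[mu]_x (phi (u, x))%:E = J%:E)%E.

Local Notation G x u := (\sum_(j < n) phi (u, tnth x j)).
Hypothesis rowsum : forall u, (pw mu n [set x | (M < G x u)%R] <= delta%:E)%E.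

Local Notation Tn := (n.-tuple T).
Local Notation Q := (pw mu n).
Local Notation g x u := (Num.min (G x u) M).

Definition psi (x : T) : R := fine (\int[mu]_u (phi (u, x))%:E)%E.
(** Conditional mean of one truncated row sum when the first sample is [x]. Without truncation it
    would be the sum of [psi] over [x]. *)
Definition trunc_mean (x : Tn) : R := fine (\int[mu]_u (g x u)%:E)%E.

Let phi0 z : 0 <= phi z. Proof. by have /andP[] := phi01 z. Qed.

Let psiE x : (\int[mu]_u (phi (u, x))%:E = (psi x)%:E)%E.
Proof.
rewrite /psi fineK// ge0_fin_numE; first by rewrite (le_lt_trans (phi_r x))// ltry.
by apply: integral_ge0 => u _; rewrite lee_fin.
Qed.

Let psi_bnd x : 0 <= psi x <= omega.
Proof.
rewrite -!lee_fin -psiE phi_r andbT.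
by apply: integral_ge0 => u _; rewrite lee_fin.
Qed.

Let mpsi : measurable_fun setT psi.
Proof.
apply: (measurableT_comp (fine_measurable measurableT)).
exact: measurable_integral_fst.
Qed.

Let intpsi : (\int[mu]_x (psi x)%:E = J%:E)%E.
Proof. by under eq_integral do rewrite -psiE; rewrite -integral_swap. Qed.

Let mG : measurable_fun setT (fun z : Tn * T => G z.1 z.2).
Proof.
apply: measurable_sum => j; apply: measurableT_comp => //.
apply: measurable_fun_pair => //.
exact: (measurableT_comp (measurable_tnth j) measurable_fst).
Qed.

Let mg : measurable_fun setT (fun z : Tn * T => g z.1 z.2).
Proof. by apply: (measurable_minr mG). Qed.

Let g_bnd x u : 0 <= g x u <= M.
Proof. by rewrite le_min ge_min lexx orbT (ltW M0) sumr_ge0. Qed.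

Let g0 (z : Tn * T) : 0 <= g z.1 z.2.
Proof. by have /andP[] := g_bnd z.1 z.2. Qed.

Let mgx x : measurable_fun setT (fun u => g x u).
Proof. exact: (measurable_section1 mg x). Qed.

Let mGx x : measurable_fun setT (fun u => G x u).
Proof. exact: (measurable_section1 mG x). Qed.

Let tmE x : (\int[mu]_u (g x u)%:E = (trunc_mean x)%:E)%E.
Proof.
rewrite /trunc_mean fineK// ge0_fin_numE.
  apply: (@le_lt_trans _ _ M%:E); last exact: ltry.
  apply: integral_le_cst => //; first exact/measurable_EFinP.
  - by move=> u; rewrite lee_fin; have /andP[] := g_bnd x u.
  - by move=> u; rewrite lee_fin; have /andP[] := g_bnd x u.
by apply: integral_ge0 => u _; rewrite lee_fin; have /andP[] := g_bnd x u.
Qed.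

Let mtm : measurable_fun setT trunc_mean.
Proof.
apply: (measurableT_comp (fine_measurable measurableT)).
exact: (measurable_integral_snd mu mg g0).
Qed.

Let intG x : (\int[mu]_u (G x u)%:E = (\sum_(j < n) psi (tnth x j))%:E)%E.
Proof.
under eq_integral do rewrite -sumEFin.
rewrite ge0_integral_sum//.
- by rewrite -sumEFin; apply: eq_bigr => j _; rewrite psiE.
- move=> j; apply/measurable_EFinP; apply: measurableT_comp => //; exact: measurable_pair2.
- by move=> j u _; rewrite lee_fin.
Qed.

Let tm_le x : trunc_mean x <= \sum_(j < n) psi (tnth x j).
Proof.
rewrite -lee_fin -tmE -intG; apply: ge0_le_integral => //.
- by move=> u _; rewrite lee_fin; have /andP[] := g_bnd x u.
- exact/measurable_EFinP.
- exact/measurable_EFinP.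
- by move=> u _; rewrite lee_fin ge_min lexx.
Qed.

Let mPsi : measurable_fun setT (fun x : Tn => \sum_(j < n) psi (tnth x j)).
Proof. exact: measurable_tuple_sum. Qed.

(** The exceptional events. [E1], [E1']: the sum of [psi] over [x] is far from its mean. [E2],
    [E2']: given [x], the truncated double sum is far from its conditional mean. [E0]: an actual row
    sum exceeds the cutoff. [E3]: truncation costs at least 1 in the conditional mean of the double
    sum. *)
Let E1 : set Tn := [set x | 3 / 2 * (n%:R * J) + 3 * omega * l <= \sum_(j < n) psi (tnth x j)].
Let E1' : set Tn := [set x | \sum_(j < n) psi (tnth x j) <= 1 / 2 * (n%:R * J) - omega * l].
Let E3 : set Tn := [set x | 1 <= n%:R * (\sum_(j < n) psi (tnth x j) - trunc_mean x)].
Let E2 : set (Tn * Tn) :=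
  [set z | 3 / 2 * (n%:R * trunc_mean z.1) + 3 * M * l <= \sum_(i < n) g z.1 (tnth z.2 i)].
Let E2' : set (Tn * Tn) :=
  [set z | \sum_(i < n) g z.1 (tnth z.2 i) <= 1 / 2 * (n%:R * trunc_mean z.1) - M * l].
Let E0 : set (Tn * Tn) := [set z | exists2 i, i \in enum 'I_n & M < G z.1 (tnth z.2 i)].

Let mexp : measurable_fun setT (fun x : Tn => n%:R * (\sum_(j < n) psi (tnth x j) - trunc_mean x)).
Proof. by apply: measurable_funM => //; apply: measurable_funB. Qed.

Let I := [set z : Tn * T | M < G z.1 z.2].
Let mI : measurable I. Proof. exact: measurable_gt_fun. Qed.
Let h (z : Tn * T) : R := n%:R * \1_I z.
Let mh : measurable_fun setT h. Proof. exact: measurable_funM. Qed.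
Let h0 z : 0 <= h z. Proof. by rewrite mulr_ge0. Qed.

(** Truncation changes a row sum only where it exceeds [M], and there by at most [n], because each
    of its [n] terms is at most 1. *)
Let excess_le x : ((\sum_(j < n) psi (tnth x j) - trunc_mean x)%:E <=
    \int[mu]_u (h (x, u))%:E)%E.
Proof.
rewrite EFinB leeBlDr// -intG -tmE -ge0_integralD//; last 4 first.
- by move=> u _; rewrite lee_fin.
- by apply/measurable_EFinP; exact: measurable_section1.
- by move=> u _; rewrite lee_fin; have /andP[] := g_bnd x u.
- exact/measurable_EFinP.
apply: ge0_le_integral => //.
- by move=> u _; rewrite lee_fin sumr_ge0.
- exact/measurable_EFinP.
- apply: emeasurable_funD; last exact/measurable_EFinP.
  by apply/measurable_EFinP; exact: measurable_section1.
- move=> u _; rewrite -EFinD lee_fin /h indicE.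
  have Gn : G x u <= n%:R.
    rewrite -[n in leRHS]card_ord -sumr_const ler_sum// => j _.
    by have /andP[] := phi01 (u, tnth x j).
  case: (boolP (_ \in _)) => [_|].
    by rewrite mulr1 ler_wpDr//; have /andP[] := g_bnd x u.
  rewrite notin_setE /I /= => /negP; rewrite -leNgt => GM.
  by rewrite mulr0 add0r le_min lexx.
Qed.

(** Markov's inequality at level 1, then an exchange of integrals: for fixed [u] the inner integral
    over [x] is the tail probability in [rowsum]. One factor [n] comes from [E3], the other from
    [excess_le]. *)
Let QE3 : (Q E3 <= (n%:R * (n%:R * delta))%:E)%E.
Proof.
have e0 x : 0 <= n%:R * (\sum_(j < n) psi (tnth x j) - trunc_mean x).
  by rewrite mulr_ge0// subr_ge0.
have := markov_ge0 Q mexp e0 ler01; rewrite mul1e => /le_trans; apply.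
apply: (@le_trans _ _ (\int[Q]_x (n%:R%:E * \int[mu]_u (h (x, u))%:E))%E).
  apply: ge0_le_integral => //.
  - by move=> x _; rewrite lee_fin.
  - exact/measurable_EFinP.
  - by apply: emeasurable_funM => //; exact: measurable_integral_snd.
  - by move=> x _; rewrite EFinM lee_wpmul2l// ?lee_fin.
rewrite ge0_integralZl_EFin//; last 2 first.
- by move=> x _; apply: integral_ge0 => u _; rewrite lee_fin.
- exact: measurable_integral_snd.
rewrite EFinM lee_wpmul2l ?lee_fin// integral_swap//.
apply: integral_le_cst => //.
- exact: measurable_integral_fst.
- by move=> x; apply: integral_ge0 => u _; rewrite lee_fin.
- move=> u; under eq_integral do rewrite EFinM.
  rewrite ge0_integralZl_EFin//; last first.
    by apply/measurable_EFinP; apply: (measurable_section2 (h := \1_I)).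
  rewrite EFinM lee_wpmul2l ?lee_fin//.
  rewrite (eq_integral (fun x => (\1_[set x : Tn | M < G x u] x)%:E)); last first.
    by move=> x _; congr (_%:E); rewrite !indicE; congr (_%:R); apply/idP/idP; rewrite !inE.
  rewrite integral_indic ?setIT//; first exact: rowsum.
  by apply: measurable_gt_fun => //; exact: (measurable_section2 mG u).
Qed.

Let mgi i : measurable_fun setT (fun z : Tn * Tn => g z.1 (tnth z.2 i)).
Proof.
exact: (measurableT_comp mg (measurable_fun_pair measurable_fst
  (measurableT_comp (measurable_tnth i) measurable_snd))).
Qed.

Let mGi i : measurable_fun setT (fun z : Tn * Tn => G z.1 (tnth z.2 i)).
Proof.
exact: (measurableT_comp mG (measurable_fun_pair measurable_fst
  (measurableT_comp (measurable_tnth i) measurable_snd))).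
Qed.

Let mE2 : measurable E2.
Proof.
apply: measurable_ge_fun; last exact: measurable_sum.
apply: measurable_funD => //; apply: measurable_funM => //; apply: measurable_funM => //.
exact: (measurableT_comp mtm measurable_fst).
Qed.

Let mE2' : measurable E2'.
Proof.
apply: measurable_ge_fun; first exact: measurable_sum.
apply: measurable_funB => //; apply: measurable_funM => //; apply: measurable_funM => //.
exact: (measurableT_comp mtm measurable_fst).
Qed.

Let mE0i i : measurable [set z : Tn * Tn | M < G z.1 (tnth z.2 i)].
Proof. exact: measurable_gt_fun. Qed.

Let mE0 : measurable E0.
Proof. exact: measurable_exists_in. Qed.

Let mE1 : measurable E1. Proof. exact: measurable_ge_fun. Qed.
Let mE1' : measurable E1'. Proof. exact: measurable_ge_fun. Qed.
Let mE3 : measurable E3. Proof. exact: measurable_ge_fun. Qed.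

Let mlift (B : set Tn) : measurable B -> measurable [set z : Tn * Tn | B z.1].
Proof. by move=> mB; rewrite -[X in measurable X]setTI; exact: measurable_fst. Qed.

Lemma decoupled_deviation : exists B : set (Tn * Tn),
  [/\ measurable B,
   ((Q \x Q) B <= (4 * expR (- l) + n%:R * delta + n%:R * (n%:R * delta))%:E)%E &
   forall x y : Tn, ~ B (x, y) ->
   let S := \sum_(i < n) \sum_(j < n) phi (tnth y i, tnth x j) in
   S <= 9 / 4 * (n%:R ^+ 2 * J) + 9 / 2 * (n%:R * omega) * l + 3 * M * l /\
   1 / 4 * (n%:R ^+ 2 * J) - 1 / 2 * (n%:R * omega) * l - 1 / 2 - M * l <= S].
Proof.
exists ([set z | E1 z.1] `|` [set z | E1' z.1] `|` E2 `|` E2' `|` E0 `|` [set z | E3 z.1]).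
have ml1 := mlift mE1; have ml1' := mlift mE1'; have ml3 := mlift mE3.
split; first by do !apply: measurableU.
  have b1 : ((Q \x Q) [set z | E1 z.1] <= (expR (- l))%:E)%E.
    by rewrite product_measure_fst//; exact: chernoff_above.
  have b1' : ((Q \x Q) [set z | E1' z.1] <= (expR (- l))%:E)%E.
    by rewrite product_measure_fst//; exact: chernoff_below.
  have b3 : ((Q \x Q) [set z | E3 z.1] <= (n%:R * (n%:R * delta))%:E)%E.
    by rewrite product_measure_fst//; exact: QE3.
  have b2 : ((Q \x Q) E2 <= (expR (- l))%:E)%E.
    apply: product_measure_le_xsection => // x.
    by apply: (chernoff_above n (mgx x) (tmE x) M0) => u.
  have b2' : ((Q \x Q) E2' <= (expR (- l))%:E)%E.
    apply: product_measure_le_xsection => // x.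
    by apply: (chernoff_below n (mgx x) (tmE x) M0) => u.
  have b0 : ((Q \x Q) E0 <= (n%:R * delta)%:E)%E.
    rewrite -[n in (n%:R)%R]size_enum_ord.
    apply: measure_exists_in_le => // i _.
    have : ((Q \x Q) [set z | M < G z.1 (tnth z.2 i)]%R <= delta%:E)%E.
      by apply: product_measure_le_ysection => // y; have := rowsum (tnth y i).
    by [].
  rewrite (_ : 4 * expR (- l) + _ + _ = expR (- l) + expR (- l) + expR (- l) + expR (- l)
    + n%:R * delta + n%:R * (n%:R * delta)); last by ring.
  do 5 (apply: (le_trans (measureU2 _ _ _)); [by do ?apply: measurableU|by []|rewrite EFinD leeD//]).
move=> x y /not_orP[/not_orP[/not_orP[/not_orP[/not_orP[]]]]].
rewrite /E1 /E1' /E2 /E2' /E3 /= => /negP + /negP + /negP + /negP + h0' /negP.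
rewrite -!ltNge.
(* Off [E0] the cutoff is inactive at the sample points, so the statistic is the untruncated double
   sum. *)
have -> : \sum_(i < n) g x (tnth y i) = \sum_(i < n) G x (tnth y i).
  apply: eq_bigr => i _; apply: min_l; rewrite leNgt; apply/negP => MG.
  by apply: h0'; exists i; rewrite ?mem_enum.
set S := \sum_(i < n) _; set Psi := \sum_(j < n) _ => H1 H2 H3 H4 H5.
have n0' : 0 < n%:R :> R by rewrite ltr0n.
(* The two Chernoff bounds are chained: 9/4 is 3/2 squared, 1/4 is 1/2 squared, and the isolated 1/2
   is half of the truncation cost allowed off [E3]. *)
have t1 : n%:R * trunc_mean x <= n%:R * Psi := ler_wpM2l (ltW n0') (tm_le x).
have t2 := ler_wpM2l (ltW n0') (ltW H1).
have t3 := ler_wpM2l (ltW n0') (ltW H2).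
split; lra.
Qed.

End decoupled_statistic.

(** * Counts in countably many cells *)

Section counts.
Context d (T : measurableType d) (R : realType) (mu : probability T R) (n : nat).
Local Notation Tn := (n.-tuple T).
Local Notation Q := (pw mu n).

Definition count_in (C : set T) (x : Tn) : R := \sum_(j < n) \1_C (tnth x j).

Lemma measurable_count_in C : measurable C -> measurable_fun setT (count_in C).
Proof. by move=> mC; exact: (measurable_tuple_sum (g := \1_C)). Qed.

Lemma integral_indic_fine C : measurable C ->
  (\int[mu]_x (\1_C x)%:E = (fine (mu C))%:E)%E.
Proof. by move=> mC; rewrite integral_indic// setIT fineK// fin_num_measure. Qed.

(** The parameter [lam] stays free because the bandwidth regimes need different values: a constant
    in one, half of [|ln (m V_h)|] in the other. *)
Lemma rowsum_tail (g : T -> R) (omega lam M : R) : measurable_fun setT g ->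
  (forall x, 0 <= g x <= 1) -> (\int[mu]_x (g x)%:E <= omega%:E)%E -> 0 <= lam ->
  (Q [set x | (M < \sum_(j < n) g (tnth x j))%R] <=
   (expR (n%:R * omega * (expR lam - 1) - lam * M))%:E)%E.
Proof.
move=> mg g01 gw lam0.
have intg : (\int[mu]_x (g x)%:E = (fine (\int[mu]_x (g x)%:E))%:E)%E.
  rewrite fineK// ge0_fin_numE; first by rewrite (le_lt_trans gw)// ltry.
  by apply: integral_ge0 => x _; rewrite lee_fin; have /andP[] := g01 x.
have mS : measurable_fun setT (fun x : Tn => \sum_(j < n) g (tnth x j)).
  exact: measurable_tuple_sum.
apply: le_trans (le_trans (chernoff_unit n mg intg g01 lam (lam * M)) _).
  apply: le_measure; rewrite ?inE; last by move=> x /= Mx; rewrite ler_wpM2l// ltW.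
  - exact: measurable_gt_fun.
  - by apply: measurable_ge_fun => //; exact: measurable_funM.
rewrite lee_fin ler_expR lerB// -mulrA ler_wpM2l// mulrC ler_wpM2r//.
  by rewrite subr_ge0 -expR0 ler_expR.
by rewrite -lee_fin -intg.
Qed.

(* The factor [fine (mu C)] comes from Markov's inequality for [expR (lam * N) - 1]
   instead of [expR (lam * N)]; it makes the bounds summable over the cells [C]. *)
Lemma count_tail C (w l : R) : measurable C -> n%:R * fine (mu C) <= w ->
  256 * l <= w -> 1 <= l ->
  (Q [set x | (5 / 4 * w <= count_in C x)%R] <=
   (n%:R * fine (mu C) * expR (- (3 * l)))%:E)%E.
Proof.
move=> mC pw_le lw l1.
set p := fine (mu C) in pw_le *.
have p0 : 0 <= p by exact: fine_ge0.
have ip := integral_indic_fine mC; rewrite -/p in ip.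
have ind01 x : 0 <= (\1_C x : R) <= 1 by rewrite indicE ler0n lern1 leq_b1.
(* At the threshold the exponent is 5/32 w, while the transform contributes at most w/7. The margin
   (5/32 - 1/7) w = 3/224 w exceeds 3 l as soon as w >= 256 l. *)
set lam : R := 1/8.
set A := n%:R * ((expR lam - 1) * p).
have elam : expR lam - 1 <= 1/7.
  have := @expR_le_inv R lam; rewrite (_ : (1 - lam)^-1 = 8/7); last by rewrite /lam; field.
  by rewrite /lam => h; have := h (ltac:(lra)); lra.
have elam0 : 0 <= expR lam - 1 by rewrite subr_ge0 -expR0 ler_expR /lam; lra.
have np0 : 0 <= n%:R * p by exact: mulr_ge0.
have A0 : 0 <= A by rewrite /A mulr_ge0// mulr_ge0.
have A7 : A <= 1/7 * (n%:R * p).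
  by rewrite /A mulrCA ler_wpM2r.
have mc := measurable_count_in mC.
have mE : measurable_fun setT (fun x : Tn => expR (lam * count_in C x) - 1).
  apply: measurable_funB => //; apply: measurableT_comp => //; exact: measurable_funM.
have c0 x : 0 <= count_in C x by rewrite sumr_ge0.
have E0 x : 0 <= expR (lam * count_in C x) - 1.
  by rewrite subr_ge0 -expR0 ler_expR mulr_ge0// /lam; lra.
have intE : (\int[Q]_x (expR (lam * count_in C x) - 1)%:E <= (A * expR A)%:E)%E.
  apply: (@le_trans _ _ (expR A - 1)%:E); last by rewrite lee_fin expRB1_le.
  have := integral_mgf n (measurable_indic mC) ip ind01 lam.
  rewrite -/A.
  rewrite (eq_integral (fun x => (expR (lam * count_in C x) - 1)%:E + 1%:E)%E); last first.
    by move=> x _; rewrite -EFinD subrK.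
  rewrite ge0_integralD//; last 2 first.
  - by move=> x _; rewrite lee_fin.
  - exact/measurable_EFinP.
  by rewrite integral_cst//= [X in (1 * X)%E]probability_setT mule1 -leeBrDr// EFinB.
set th := expR (5 / 32 * w) - 1.
have w0 : 256 <= w by lra.
(* Subtracting 1 costs at most a factor 2, since 5/32 w >= 40. *)
have th1 : expR (5 / 32 * w) / 2 <= th.
  rewrite /th; have := @expR_ge1Dx R (5/32 * w); lra.
have th0 : 0 < th by rewrite (lt_le_trans _ th1)// divr_gt0// expR_gt0.
have := markov_ge0 Q mE E0 (ltW th0).
rewrite (_ : [set x | th <= _] = [set x | 5 / 4 * w <= count_in C x]); last first.
  apply/seteqP; split=> x /=; rewrite /th lerD2r ler_expR /lam => h; lra.
move=> /le_trans/(_ intE).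
rewrite -lee_pdivlMl// -EFinM => /le_trans; apply; rewrite lee_fin.
rewrite mulrC ler_pdivrMr//.
apply: (@le_trans _ _ (n%:R * p * expR (- (3 * l)) * (expR (5 / 32 * w) / 2))); last first.
  by rewrite ler_wpM2l// mulr_ge0// expR_ge0.
rewrite (_ : _ * (_ / 2) = n%:R * p * expR (- (3 * l) + 5 / 32 * w) / 2); last first.
  by rewrite expRD; ring.
have h1 : expR A <= expR (- (3 * l) + 5 / 32 * w) by rewrite ler_expR; lra.
apply: (@le_trans _ _ (1/7 * (n%:R * p) * expR (- (3 * l) + 5 / 32 * w))).
  by apply: ler_pM => //; rewrite expR_ge0.
have := mulr_ge0 np0 (expR_ge0 (- (3 * l) + 5 / 32 * w)); lra.
Qed.

Lemma count_below C (l : R) : measurable C ->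
  (Q [set x | (count_in C x <= 1 / 2 * (n%:R * fine (mu C)) - l)%R] <= (expR (- l))%:E)%E.
Proof.
move=> mC; have ind01 x : 0 <= (\1_C x : R) <= 1 by rewrite indicE ler0n lern1 leq_b1.
have := chernoff_below n (measurable_indic mC) (integral_indic_fine mC) ltr01 ind01 l.
by rewrite (mul1r l).
Qed.

Section family.
Context (K : countType) (C : K -> set T) (c : R) (w l : R).
Hypothesis mC : forall k, measurable (C k).
Hypothesis mult : forall u (r : seq K), uniq r -> (forall k, k \in r -> C k u) -> (size r)%:R <= c.
Hypothesis pw_le : forall k, n%:R * fine (mu (C k)) <= w.
Hypothesis lw : 256 * l <= w.
Hypothesis l1 : 1 <= l.

(** Enumeration of the cells by integers. [pickle_inv] reaches every [k] from exactly one index, so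
    no cell is counted twice and [mult] applies to the partial sums. *)
Let D (i : nat) : set T := if pickle_inv i is Some k then C k else set0.

Let mD i : measurable (D i).
Proof. by rewrite /D; case: pickle_inv. Qed.

Let sumD N u : \sum_(i < N) \1_(D i) u <= c.
Proof.
have -> : \sum_(i < N) \1_(D i) u =
    (size [seq k <- pmap (@pickle_inv K) (iota 0 N) | u \in C k])%:R :> R.
  rewrite -(big_mkord xpredT (fun i => \1_(D i) u : R)) /index_iota subn0.
  elim: (iota 0 N) => [|i s IH]; first by rewrite big_nil.
  rewrite big_cons IH /= /D; case: pickle_inv => [k|] /=; last by rewrite indic0 add0r.
  by rewrite indicE; case: (u \in C k) => /=; [rewrite -[in RHS]natr1 addrC|rewrite add0r].
apply: (mult (u := u)) => [|k]; last by rewrite mem_filter => /andP[/set_mem].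
by apply: filter_uniq; apply: (pmap_uniq (@pickle_invK K)); exact: iota_uniq.
Qed.

Lemma counts_above : exists B : set Tn, [/\ measurable B,
  (Q B <= (n%:R * c * expR (- (3 * l)))%:E)%E &
  forall x, ~ B x -> forall k, count_in (C k) x <= 5 / 4 * w].
Proof.
pose F i := [set x : Tn | 5 / 4 * w < count_in (D i) x].
have mF i : measurable (F i).
  by apply: measurable_gt_fun => //; exact: measurable_count_in.
exists (\bigcup_i F i); split.
- exact: bigcup_measurable.
- apply: (@le_trans _ _ (\sum_(i <oo) Q (F i))%E).
    by apply: measure_sigma_subadditive => //; exact: bigcup_measurable.
  apply: lime_le; first by apply: is_cvg_nneseries.
  apply: nearW => N /=; rewrite big_mkord.
  have QF i : (Q (F i) <= (n%:R * fine (mu (D i)) * expR (- (3 * l)))%:E)%E.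
    have w0 : 0 <= w by move: lw l1 => ? ?; lra.
    have h : n%:R * fine (mu (D i)) <= w.
      by rewrite /D; case: pickle_inv => [k|]; [exact: pw_le|rewrite measure0 mulr0].
    apply: le_trans (count_tail (mD i) h lw l1).
    apply: le_measure; rewrite ?inE//; last by move=> x /ltW.
    by apply: measurable_ge_fun => //; exact: measurable_count_in.
  apply: (@le_trans _ _ (\sum_(i < N) (n%:R * fine (mu (D i)) * expR (- (3 * l)))%:E)%E).
    by apply: lee_sum => i _; exact: QF.
  rewrite sumEFin lee_fin -mulr_suml ler_wpM2r ?expR_ge0// -mulr_sumr ler_wpM2l//.
  rewrite -lee_fin -sumEFin.
  under eq_bigr do rewrite -integral_indic_fine//.
  rewrite -ge0_integral_sum//; last first.
    by move=> i; apply/measurable_EFinP.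
  apply: integral_le_cst => //.
  + by apply: emeasurable_sum => i; apply/measurable_EFinP.
  + by move=> x; apply: sume_ge0.
  + by move=> x; rewrite sumEFin lee_fin.
- move=> x NB k; rewrite leNgt; apply/negP => h; apply: NB.
  by exists (pickle k) => //; rewrite /F /= /D pickleK_inv.
Qed.

End family.
End counts.

(** * Lebesgue measure, densities and the norms of the kernel *)

Section density.
Context d (T : measurableType d) (R : realType).
Import HBNNSimple.
Local Open Scope ereal_scope.

(** Indicators, then simple functions, then monotone limits; everything is nonnegative, so no
    integrability is involved. *)
Lemma integral_density (lam mu : {measure set T -> \bar R}) (f g : T -> R) :
  measurable_fun setT f -> (forall x, 0 <= f x)%R ->
  (forall A, measurable A -> mu A = \int[lam]_(x in A) (f x)%:E) ->
  measurable_fun setT g -> (forall x, 0 <= g x)%R ->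
  \int[mu]_x (g x)%:E = \int[lam]_x (g x * f x)%:E.
Proof.
move=> mf f0 muE mg g0.
have indicE (A : set T) : measurable A ->
    \int[mu]_x (\1_A x)%:E = \int[lam]_x (\1_A x * f x)%:E.
  move=> mA; rewrite integral_indic// setIT muE// integral_mkcond.
  by apply: eq_integral => x _; rewrite /patch indicE; case: ifP => _; rewrite ?mul1r ?mul0r.
have simple (h : {nnsfun T >-> R}) :
    \int[mu]_x (h x)%:E = \int[lam]_x (h x * f x)%:E.
  transitivity (\sum_(y \in range h) y%:E * \int[mu]_x (\1_(h @^-1` [set y]) x)%:E).
    under eq_integral do rewrite fimfunE -fsumEFin//.
    rewrite ge0_integral_fsum//; last 2 first.
    - by move=> r; apply/measurable_EFinP/measurable_funM.
    - by move=> r x _; rewrite nnfun_muleindic_ge0.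
    by apply: eq_fsbigr => y _; rewrite integralZl_indic_nnsfun.
  transitivity (\sum_(y \in range h) \int[lam]_x (y * \1_(h @^-1` [set y]) x * f x)%:E).
    apply: eq_fsbigr => y yh; rewrite indicE//.
    have y0 : (0 <= y)%R by move/set_mem: yh => [x _ <-].
    rewrite -ge0_integralZl_EFin//.
    - by apply: eq_integral => x _; rewrite -EFinM mulrA.
    - by move=> x _; rewrite lee_fin mulr_ge0.
    - by apply/measurable_EFinP/measurable_funM.
  under [RHS]eq_integral do rewrite fimfunE mulr_fsuml// -fsumEFin//.
  rewrite ge0_integral_fsum//.
  - by move=> r; apply/measurable_EFinP/measurable_funM => //; apply: measurable_funM.
  - move=> r x _; rewrite lee_fin mulr_ge0//.
    by have := nnfun_muleindic_ge0 h r x; rewrite -lee_fin.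
have mg' : measurable_fun setT (EFin \o g) by exact/measurable_EFinP.
pose h := nnsfun_approx measurableT mg'.
have hg x : (h n x)%:E @[n --> \oo] --> (g x)%:E.
  by apply: (cvg_nnsfun_approx measurableT mg') => // y _; rewrite lee_fin.
have nd x : nondecreasing_seq (fun n => h n x).
  by move=> a b ab; exact/lefP/nd_nnsfun_approx.
transitivity (limn (fun n => \int[mu]_x (h n x)%:E)).
  rewrite -monotone_convergence//.
  - by apply: eq_integral => x _; apply/esym/cvg_lim => //; exact: hg.
  - by move=> n; apply/measurable_EFinP.
  - by move=> n x _; rewrite lee_fin.
  - by move=> x _ a b ab; rewrite lee_fin nd.
under eq_fun do rewrite simple.
rewrite -monotone_convergence//.
- apply: eq_integral => x _; apply/cvg_lim => //.
  under eq_fun do rewrite EFinM.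
  by rewrite EFinM; apply: cvgeZr => //; exact: hg.
- by move=> n; apply/measurable_EFinP; apply: measurable_funM.
- by move=> n x _; rewrite lee_fin mulr_ge0.
- by move=> x _ a b ab; rewrite lee_fin ler_wpM2r// nd.
Qed.

End density.

Section lebesgue_reflected_dilation.
Context (R : realType) (d : nat).
Implicit Types (u h : d.-tuple R).

Lemma lebesgue_measure_preimage (a c : R) (A : set R) : 0 < c -> measurable A ->
  lebesgue_measure ((fun z => (a - z) / c) @^-1` A) = (c%:E * lebesgue_measure A)%E.
Proof.
move=> c0 mA.
have mphi : measurable_fun setT (fun z : measurableTypeR R => ((a - z) / c : measurableTypeR R)).
  by apply: measurable_funM => //; apply: measurable_funB.
have ci0 : 0 <= c^-1 by rewrite invr_ge0 ltW.
pose k : {nonneg R} := NngNum ci0.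
suff : lebesgue_measure A = mscale k (pushforward lebesgue_measure (fun z : measurableTypeR R => ((a - z) / c : measurableTypeR R))) A.
  by move=> /(_ mphi) ->; rewrite /mscale /pushforward /= muleA -EFinM divff ?gt_eqF// mul1e.
move=> m; apply: lebesgue_measure_unique => //= _ [[x y]] _ <-.
rewrite /mscale /= /pushforward.
(* The reflection moves the closed end to the other side, which leaves the length unchanged. *)
rewrite (_ : _ @^-1` _ = `[(a - c * y), (a - c * x)[%classic); last first.
  apply/seteqP; split=> z /=; rewrite !in_itv/= ltr_pdivlMr// ler_pdivrMr// => /andP[h1 h2];
    apply/andP; split; lra.
rewrite !lebesgue_measure_itv/= !lte_fin.
rewrite (_ : (a - c * y < a - c * x) = (x < y)); last by rewrite ltrD2l ltrN2 ltr_pM2l.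
case: ifP => // _; last by rewrite mule0.
by rewrite -!EFinD -EFinM; congr (_%:E); field; rewrite gt_eqF.
Qed.

(** The argument at which [rescaled U h (vsub u z)] evaluates [U], as a function of the integration
    variable [z]. *)
Definition reflect_dilate u h (z : d.-tuple R) := vdiv (vsub u z) h.

Lemma measurable_reflect_dilate u h : measurable_fun setT (reflect_dilate u h).
Proof.
apply/measurable_fun_tnthP => i.
rewrite (_ : _ \o _ = fun z => (tnth u i - tnth z i) / tnth h i).
  apply: measurable_funM => //; apply: measurable_funB => //.
  exact: measurable_tnth.
by apply/funext => z /=; rewrite !tnth_mktuple.
Qed.

(** After division by [vol h] both sides are measures in [A] that agree on boxes, where the
    coordinates separate. *)
Lemma measure_reflect_dilate u h (A : set (d.-tuple R)) :
  (forall j, 0 < tnth h j) -> measurable A ->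
  leb R d (reflect_dilate u h @^-1` A) = ((vol h)%:E * leb R d A)%E.
Proof.
move=> h0 mA.
have V0 : 0 < vol h by apply: prodr_gt0.
have Vi0 : 0 <= (vol h)^-1 by rewrite invr_ge0 ltW.
pose k : {nonneg R} := NngNum Vi0.
have mphi := measurable_reflect_dilate u h.
pose nu : {measure set (d.-tuple R) -> \bar R} :=
  measure_function_pushforward__canonical__measure_function_Measure (leb R d) mphi.
suff : leb R d A = mscale k nu A.
  by move=> ->; rewrite /mscale /= muleA -EFinM divff ?gt_eqF// mul1e.
apply: (@tuple_measure_unique _ _ _ _ (fun n : nat => `[- n%:R, n%:R]%classic : set R)
   (leb R d) (mscale k nu)) => //.
- move=> a b ab; apply/subsetPset => x /=; rewrite !in_itv/= => /andP[x1 x2].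
  have ab' : a%:R <= b%:R :> R by rewrite ler_nat.
  by apply/andP; split; lra.
- rewrite -subTset => x _; exists (Num.bound `|x|) => //=.
  by rewrite in_itv/= -ler_norml ltW// archi_boundP.
- move=> B mB.
  transitivity (((vol h)^-1)%:E * leb R d (reflect_dilate u h @^-1` box B))%E; last by [].
  have -> : leb R d (reflect_dilate u h @^-1` box B) = ((vol h)%:E * leb R d (box B))%E.
    rewrite (_ : _ @^-1` _ = box (fun i => (fun z => (tnth u i - z) / tnth h i) @^-1` B i)); last first.
      by apply/seteqP; split=> z /= hz i; have := hz i; rewrite !tnth_mktuple.
    rewrite !leb_box//; last first.
      move=> i; rewrite -[X in measurable X]setTI.
      suff : measurable_fun setT (fun z : R => (tnth u i - z) / tnth h i).
        by move=> mz; exact: mz.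
      by apply: measurable_funM => //; apply: measurable_funB.
    rewrite /vol -prodEFin -big_split/=; apply: eq_bigr => i _.
    exact: lebesgue_measure_preimage.
  by rewrite muleA -EFinM /= mulVf ?gt_eqF// mul1e.
- move=> n; rewrite leb_box//.
  rewrite (eq_bigr (fun=> (2 * n%:R)%:E)); last first.
    move=> i _; rewrite lebesgue_measure_itv/= lte_fin.
    case: ifPn => [_|]; first by rewrite -EFinD; congr (_%:E); ring.
    rewrite -leNgt => n0; congr (_%:E); have : 0 <= n%:R :> R by []. lra.
  by rewrite prodEFin ltry.
Qed.

Lemma integral_reflect_dilate u h (F : d.-tuple R -> R) :
  (forall j, 0 < tnth h j) -> measurable_fun setT F -> (forall x, 0 <= F x) ->
  (\int[leb R d]_z (F (reflect_dilate u h z))%:E =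
   (vol h)%:E * \int[leb R d]_x (F x)%:E)%E.
Proof.
move=> h0 mF F0.
have V0 : 0 < vol h by apply: prodr_gt0.
have mphi := measurable_reflect_dilate u h.
transitivity (\int[pushforward (leb R d) (reflect_dilate u h)]_x (F x)%:E)%E.
  rewrite [RHS]ge0_integral_pushforward ?preimage_setT//.
  - exact/measurable_EFinP.
  - by move=> y _; rewrite lee_fin.
pose c' : {nonneg R} := NngNum (ltW V0).
rewrite (eq_measure_integral (mscale c' (leb R d))); last first.
  by move=> A mA _; have := measure_reflect_dilate u h0 mA.
rewrite ge0_integral_mscale//.
- exact/measurable_EFinP.
- by move=> x _; rewrite lee_fin.
Qed.

End lebesgue_reflected_dilation.

Section essential_bounds.
Context d (T : measurableType d) (R : realType) (mu : {measure set T -> \bar R}).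

(** Positive total mass selects the essential supremum in the definition of the norm. *)
Lemma Lnorm_pinfty_ae (f : T -> R) (c : R) : (0 < mu setT)%E ->
  ('N[mu]_(+oo)[EFin \o f] <= c%:E)%E -> {ae mu, forall x, `|f x| <= c}.
Proof.
move=> mu0; rewrite unlock mu0 => /ess_supP.
by apply: filterS => x /=; rewrite lee_fin.
Qed.

End essential_bounds.

(** * Finiteness of [varpi] and the kernel bounds it provides *)

Section varpi_bounds.
Context (R : realType) (d : nat) (U : d.-tuple R -> R).
Hypothesis U_meas : measurable_fun setT U.
Variables (M t : R).
Hypothesis U_bounded : forall x, `|U x| <= M.
Hypothesis t0 : 0 < t.
Hypothesis U_supp : forall x, U x != 0 -> forall j, - t < tnth x j < t.

Lemma leb_setT_gt0 : (0 < leb R d setT)%E.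
Proof.
pose A := box (fun _ : 'I_d => `[0, 1]%classic : set R).
have mA : measurable A by apply: measurable_tuple_box => i.
have A1 : leb R d A = 1%E.
  rewrite leb_box//; apply: big1 => i _.
  by rewrite lebesgue_measure_itv/= lte01 oppr0 adde0.
apply: (@lt_le_trans _ _ (leb R d A)); first by rewrite A1.
by apply: le_measure; rewrite ?inE.
Qed.

Let C := box (fun _ : 'I_d => `]- t, t[%classic : set R).

Let mC : measurable C.
Proof. by apply: measurable_tuple_box => i. Qed.

Let lebC : leb R d C = ((2 * t) ^+ d)%:E.
Proof.
rewrite leb_box// (eq_bigr (fun=> (2 * t)%:E)); last first.
  move=> i _; rewrite lebesgue_measure_itv/= lte_fin gt0_cp// -EFinD; congr (_%:E).
  by ring.
by rewrite prodEFin big_const_ord iter_mulr_1.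
Qed.

Let M0 : 0 <= M.
Proof. by apply: le_trans (U_bounded [tuple 0 | _ < d]). Qed.

Let Mt := (M + 1) * ((2 * t) ^+ d + 1).

(** Only the finiteness of the supremum over [p] matters: it keeps [fine] in [varpi] from returning
    its default value. The + 1 in the volume factor makes it at least 1, hence below its own [p]-th
    power, so that one bound serves all [p]. *)
Lemma Lnorm_bounded_support p : (1 <= p)%E -> ('N[leb R d]_p[EFin \o U] <= Mt%:E)%E.
Proof.
have t2 : 0 <= (2 * t) ^+ d by rewrite exprn_ge0// mulr_ge0// ltW.
have M0' := M0.
have Mt0 : 0 <= Mt by rewrite /Mt mulr_ge0//; lra.
rewrite unlock; case: p => [p p1||//]; last first.
  move=> _; rewrite leb_setT_gt0; apply/ess_supP; apply: nearW => x /=.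
  rewrite lee_fin (le_trans (U_bounded x))// /Mt.
  have := mulr_ge0 M0 t2; lra.
have {}p1 : 1 <= p by rewrite -lee_fin.
have p0 : 0 < p by lra.
suff h : (\int[leb R d]_x (`|(EFin \o U) x| `^ p) <= (Mt `^ p)%:E)%E.
  apply: (@le_trans _ _ ((Mt `^ p)%:E `^ p^-1)%E).
    apply: gt0_ler_poweR => //; first by rewrite invr_ge0 ltW.
    - by rewrite in_itv/= leey andbT integral_ge0// => x _; rewrite poweR_ge0.
    - by rewrite in_itv/= leey andbT lee_fin powR_ge0.
  by rewrite poweR_EFin -powRrM mulfV ?gt_eqF// powRr1.
apply: (@le_trans _ _ (\int[leb R d]_x ((M + 1) `^ p * \1_C x)%:E)%E).
  apply: ge0_le_integral => //.
  - by move=> x _; rewrite poweR_ge0.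
  - apply: (measurableT_comp (measurable_poweR p)).
    by apply: measurableT_comp => //; exact/measurable_EFinP.
  - by apply/measurable_EFinP; apply: measurable_funM.
  - move=> x _; rewrite /= ?poweR_EFin lee_fin indicE.
    have [U0|Un0] := eqVneq (U x) 0.
      by rewrite U0 normr0 powR0 ?gt_eqF// mulr_ge0// powR_ge0.
    rewrite mem_set; last by move=> j /=; rewrite in_itv/=; exact: U_supp.
    rewrite mulr1; apply: ge0_ler_powR => //; rewrite ?nnegrE//; [exact: ltW|lra|].
    by rewrite (le_trans (U_bounded x)); lra.
under eq_integral do rewrite EFinM.
rewrite ge0_integralZl_EFin//; last 2 first.
- exact/measurable_EFinP.
- exact: powR_ge0.
rewrite integral_indic// setIT lebC -EFinM lee_fin /Mt powRM//; [|lra|lra].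
rewrite ler_wpM2l ?powR_ge0//.
apply: (@le_trans _ _ ((2 * t) ^+ d + 1)); first by lra.
rewrite -[leLHS]powRr1; last by lra.
by rewrite ler_powR//; lra.
Qed.

Let supfin : (ereal_sup [set 'N[leb R d]_p[EFin \o U] | p in [set p : \bar R | 1 <= p]] <= Mt%:E)%E.
Proof. by apply: ge_ereal_sup => _ [p p1 <-]; exact: Lnorm_bounded_support. Qed.

Lemma varpiE : ((varpi U)%:E = maxe 1 (ereal_sup
  [set 'N[leb R d]_p[EFin \o U] | p in [set p : \bar R | 1 <= p]]))%E.
Proof.
rewrite /varpi fineK// ge0_fin_numE; last by rewrite le_max lee01.
by rewrite gt_max ltey (le_lt_trans supfin)// ltry.
Qed.

Lemma varpi_ge1 : 1 <= varpi U.
Proof. by rewrite -lee_fin varpiE le_max lexx. Qed.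

Lemma Lnorm_le_varpi p : (1 <= p)%E -> ('N[leb R d]_p[EFin \o U] <= (varpi U)%:E)%E.
Proof.
move=> p1; rewrite varpiE le_max; apply/orP; right.
by apply: ereal_sup_ubound; exists p.
Qed.

Lemma varpi_ae : {ae leb R d, forall x, `|U x| <= varpi U}.
Proof. by apply: Lnorm_pinfty_ae; [exact: leb_setT_gt0|apply: Lnorm_le_varpi; rewrite leey]. Qed.

Lemma integral_le_varpi : (\int[leb R d]_x (`|U x|)%:E <= (varpi U)%:E)%E.
Proof. by have := Lnorm_le_varpi (lexx 1%E); rewrite Lnorm1. Qed.

End varpi_bounds.

(** * Comparison of normalized majorants *)

Section normalized_majorant.
Context (R : realType).
Implicit Types (l D w j S M : R).

Definition nmaj l D w j :=
  4 * Num.sqrt (l * w * j) + 4 * Num.sqrt (l * j) + 147 * l * w + D * l.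

Let sqrt_le (x y : R) : 0 <= y -> x <= y ^+ 2 -> Num.sqrt x <= y.
Proof. by move=> y0 xy; rewrite -[leRHS]ger0_norm// -sqrtr_sqr ler_sqrt// sqr_ge0. Qed.

(** Each root on the left is at most twice its counterpart plus a linear term, checked by squaring.
    With the factors 4 the linear terms amount to 22 w l + D l: the first fits because 147 (5/4) +
    22 <= 294, the second uses up the budget 2 D l exactly. The size of [D] serves the second root,
    where a remainder linear in [w] and [D] must be dominated by a square. *)
Lemma nmaj_upper l D w w' j S : 0 <= l -> 88 <= D -> 0 <= w -> 0 <= j ->
  0 <= w' <= 5 / 4 * w -> 0 <= S -> S <= 9 / 4 * j + 9 * w * l + D * l ->
  nmaj l D w' S <= 2 * nmaj l D w j.
Proof.
move=> l0 D88 w0 j0 /andP[w'0 w'w] S0 SJ.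
have D0 : 0 <= D by lra.
set a := Num.sqrt (l * w * j); set b := Num.sqrt (l * j).
have a0 : 0 <= a by exact: sqrtr_ge0.
have b0 : 0 <= b by exact: sqrtr_ge0.
have a2 : a ^+ 2 = l * w * j by rewrite sqr_sqrtr// !mulr_ge0.
have b2 : b ^+ 2 = l * j by rewrite sqr_sqrtr// !mulr_ge0.
have wD0 : 0 <= w * D by exact: mulr_ge0.
have h1 : Num.sqrt (l * w' * S) <= 2 * a + (5 * w + D / 8) * l.
  apply: sqrt_le; first by rewrite addr_ge0 ?mulr_ge0//; lra.
  have c0 : 0 <= a * ((5 * w + D / 8) * l) by rewrite !mulr_ge0//; lra.
  have e1 : l * w' * S <= l * (5 / 4 * w) * (9 / 4 * j + 9 * w * l + D * l).
    by apply: ler_pM; rewrite ?mulr_ge0// ler_wpM2l.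
  apply: (le_trans e1).
  have e2 := mulr_ge0 (sqr_ge0 w) (sqr_ge0 l).
  have e3 := mulr_ge0 wD0 (sqr_ge0 l).
  have e4 := mulr_ge0 (sqr_ge0 D) (sqr_ge0 l).
  have e5 : 0 <= l * w * j by rewrite !mulr_ge0.
  have -> : (2 * a + (5 * w + D / 8) * l) ^+ 2 = 4 * a ^+ 2 + 4 * (a * ((5 * w + D / 8) * l))
     + 25 * (w ^+ 2 * l ^+ 2) + 5 / 4 * (w * D * l ^+ 2) + 1 / 64 * (D ^+ 2 * l ^+ 2) by field.
  have -> : l * (5 / 4 * w) * (9 / 4 * j + 9 * w * l + D * l) =
     45 / 16 * (l * w * j) + 45 / 4 * (w ^+ 2 * l ^+ 2) + 5 / 4 * (w * D * l ^+ 2) by field.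
  rewrite a2; lra.
have h2 : Num.sqrt (l * S) <= 2 * b + (1 / 2 * w + D / 8) * l.
  apply: sqrt_le; first by rewrite addr_ge0 ?mulr_ge0//; lra.
  have c0 : 0 <= b * ((1 / 2 * w + D / 8) * l) by rewrite !mulr_ge0//; lra.
  have e1 : l * S <= l * (9 / 4 * j + 9 * w * l + D * l) by rewrite ler_wpM2l.
  apply: (le_trans e1).
  have e2 := mulr_ge0 (sqr_ge0 w) (sqr_ge0 l).
  have e3 : 88 * (w * l ^+ 2) <= w * D * l ^+ 2.
    by rewrite mulrA ler_wpM2r ?sqr_ge0// mulrC ler_wpM2l.
  have e4 : 88 * (D * l ^+ 2) <= D ^+ 2 * l ^+ 2.
    by rewrite mulrA ler_wpM2r ?sqr_ge0// expr2 ler_wpM2r.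
  have e5 : 0 <= l * j by rewrite !mulr_ge0.
  have e6 := mulr_ge0 w0 (sqr_ge0 l).
  have e7 := mulr_ge0 D0 (sqr_ge0 l).
  have -> : (2 * b + (1 / 2 * w + D / 8) * l) ^+ 2 = 4 * b ^+ 2 + 4 * (b * ((1 / 2 * w + D / 8) * l))
     + 1 / 4 * (w ^+ 2 * l ^+ 2) + 1 / 8 * (w * D * l ^+ 2) + 1 / 64 * (D ^+ 2 * l ^+ 2) by field.
  have -> : l * (9 / 4 * j + 9 * w * l + D * l) =
     9 / 4 * (l * j) + 9 * (w * l ^+ 2) + D * l ^+ 2 by ring.
  rewrite b2; lra.
have h3 : l * w' <= 5 / 4 * (l * w) by rewrite mulrCA ler_wpM2l.
have lw := mulr_ge0 l0 w0.
rewrite /nmaj -/a -/b.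
lra.
Qed.

(** Same scheme as [nmaj_upper]. The factor 5 between [w] and [w'] dictates the 9: the total for w'
    l is 147 (5) + 64 = 799, against 9 (147) = 1323. *)
Lemma nmaj_lower l D w w' j S : 0 <= l -> 88 <= D -> 0 <= w' -> 0 <= j ->
  0 <= w <= 5 * w' -> 0 <= S -> j <= 4 * S + 8 * w * l + 2 * D * l ->
  nmaj l D w j <= 9 * nmaj l D w' S.
Proof.
move=> l0 D88 w'0 j0 /andP[w0 ww'] S0 SJ.
have D0 : 0 <= D by lra.
have SJ' : j <= 4 * S + 40 * w' * l + 2 * D * l.
  have := ler_wpM2r l0 ww'; lra.
set a := Num.sqrt (l * w' * S); set b := Num.sqrt (l * S).
have a0 : 0 <= a by exact: sqrtr_ge0.
have b0 : 0 <= b by exact: sqrtr_ge0.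
have a2 : a ^+ 2 = l * w' * S by rewrite sqr_sqrtr// !mulr_ge0.
have b2 : b ^+ 2 = l * S by rewrite sqr_sqrtr// !mulr_ge0.
have wD0 : 0 <= w' * D by exact: mulr_ge0.
have h1 : Num.sqrt (l * w * j) <= 5 * a + (15 * w' + D / 2) * l.
  apply: sqrt_le; first by rewrite addr_ge0 ?mulr_ge0//; lra.
  have c0 : 0 <= a * ((15 * w' + D / 2) * l) by rewrite !mulr_ge0//; lra.
  have e1 : l * w * j <= l * (5 * w') * (4 * S + 40 * w' * l + 2 * D * l).
    by apply: ler_pM; rewrite ?mulr_ge0// ler_wpM2l.
  apply: (le_trans e1).
  have e2 := mulr_ge0 (sqr_ge0 w') (sqr_ge0 l).
  have e3 := mulr_ge0 wD0 (sqr_ge0 l).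
  have e4 := mulr_ge0 (sqr_ge0 D) (sqr_ge0 l).
  have e5 : 0 <= l * w' * S by rewrite !mulr_ge0.
  have -> : (5 * a + (15 * w' + D / 2) * l) ^+ 2 = 25 * a ^+ 2 + 10 * (a * ((15 * w' + D / 2) * l))
     + 225 * (w' ^+ 2 * l ^+ 2) + 15 * (w' * D * l ^+ 2) + 1 / 4 * (D ^+ 2 * l ^+ 2) by field.
  have -> : l * (5 * w') * (4 * S + 40 * w' * l + 2 * D * l) =
     20 * (l * w' * S) + 200 * (w' ^+ 2 * l ^+ 2) + 10 * (w' * D * l ^+ 2) by ring.
  rewrite a2; lra.
have h2 : Num.sqrt (l * j) <= 2 * b + (w' + D / 4) * l.
  apply: sqrt_le; first by rewrite addr_ge0 ?mulr_ge0//; lra.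
  have c0 : 0 <= b * ((w' + D / 4) * l) by rewrite !mulr_ge0//; lra.
  have e1 : l * j <= l * (4 * S + 40 * w' * l + 2 * D * l) by rewrite ler_wpM2l.
  apply: (le_trans e1).
  have e2 := mulr_ge0 (sqr_ge0 w') (sqr_ge0 l).
  have e3 : 88 * (w' * l ^+ 2) <= w' * D * l ^+ 2.
    by rewrite mulrA ler_wpM2r ?sqr_ge0// mulrC ler_wpM2l.
  have e4 : 88 * (D * l ^+ 2) <= D ^+ 2 * l ^+ 2.
    by rewrite mulrA ler_wpM2r ?sqr_ge0// expr2 ler_wpM2r.
  have e6 := mulr_ge0 w'0 (sqr_ge0 l).
  have e7 := mulr_ge0 D0 (sqr_ge0 l).
  have -> : (2 * b + (w' + D / 4) * l) ^+ 2 = 4 * b ^+ 2 + 4 * (b * ((w' + D / 4) * l))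
     + w' ^+ 2 * l ^+ 2 + 1 / 2 * (w' * D * l ^+ 2) + 1 / 16 * (D ^+ 2 * l ^+ 2) by field.
  have -> : l * (4 * S + 40 * w' * l + 2 * D * l) =
     4 * (l * S) + 40 * (w' * l ^+ 2) + 2 * (D * l ^+ 2) by ring.
  rewrite b2; lra.
have h3 : l * w <= 5 * (l * w') by rewrite mulrCA ler_wpM2l.
have lw := mulr_ge0 l0 w'0.
have lD := mulr_ge0 D0 l0.
rewrite /nmaj -/a -/b.
lra.
Qed.

Lemma majorantE d m (a q : R) (U : d.-tuple R -> R) h W J :
  (0 < m)%N -> 0 < vol h -> 0 < varpi U ->
  let K := varpi U / (m%:R ^+ 2 * vol h) in
  majorant m a q U h W J =
  K * nmaj ((12 * q + 2) * ln m%:R) (Upsilon m a h * (12 * q + 2)) (W * (m%:R * vol h)) (J / K).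
Proof.
move=> m0 V0 vp0 K.
have m0' : 0 < m%:R :> R by rewrite ltr0n.
have K0 : 0 < K by rewrite divr_gt0// mulr_gt0// exprn_gt0.
have sq (c x : R) : 0 <= c -> c * Num.sqrt x = Num.sqrt (c ^+ 2 * x).
  by move=> c0; rewrite sqrtrM ?sqr_ge0// sqrtr_sqr ger0_norm.
rewrite /majorant /nmaj !(mulrDr K).
have nz : (m%:R != 0 :> R) * (vol h != 0) * (varpi U != 0).
  by rewrite !gt_eqF.
congr (_ + _ + _ + _).
- rewrite (mulrA K) sq; last by rewrite mulr_ge0// ltW.
  by congr (Num.sqrt _); rewrite /K; field; rewrite !nz.
- rewrite (mulrA K) sq; last by rewrite mulr_ge0// ltW.
  by congr (Num.sqrt _); rewrite /K; field; rewrite !nz.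
- by rewrite /K; field; rewrite !nz.
- by rewrite /K; field; rewrite !nz.
Qed.

End normalized_majorant.

(** * Cells and kernel at a fixed bandwidth *)

Lemma pw_coord d (T : measurableType d) (R : realType) (mu : probability T R) n
    (A : set T) (j : 'I_n) : measurable A ->
  pw mu n [set x | A (tnth x j)] = mu A.
Proof.
move=> mA; rewrite (_ : mkset _ = box (fun i => if i == j then A else setT)); last first.
  apply/seteqP; split=> x /=; first by move=> Ax i; case: eqP => // ->.
  by move=> /(_ j); rewrite eqxx.
rewrite pw_box; last by move=> i; case: ifP.
rewrite (bigD1 j)//= eqxx big1 ?mule1// => i /negPf ->.
exact: probability_setT.
Qed.

Section cells.
Context (R : realType) (d : nat) (t : R) (h : d.-tuple R).
Hypothesis t0 : 0 < t.

Definition cell_at (k : d.-tuple int) : set (d.-tuple R) :=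
  [set x | cell t k (vdiv x h)].

Lemma measurable_cell_at k : measurable (cell_at k).
Proof.
rewrite (_ : cell_at k = box (fun r => (fun z => z / tnth h r) @^-1`
    `](((tnth k r)%:~R - 1) * t), (((tnth k r)%:~R + 2) * t)]%classic)).
  apply: measurable_tuple_box => i; rewrite -[X in measurable X]setTI.
  have mz : measurable_fun setT (fun z : R => z / tnth h i) by apply: measurable_funM.
  by apply: mz.
apply/seteqP; split=> x /= hx r; have := hx r; rewrite /= ?in_itv/= tnth_mktuple//.
Qed.

Lemma cell_at_mult u (r : seq (d.-tuple int)) : uniq r ->
  (forall k, k \in r -> cell_at k u) -> (size r)%:R <= (3 ^ d)%:R :> R.
Proof.
move=> ur hr; rewrite ler_nat.
(* In each coordinate [(k - 1) t < v <= (k + 2) t] leaves the three integers from [c] to [c + 2]. *)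
pose c i : int := Num.ceil (tnth (vdiv u h) i / t) - 2.
have kc k i : k \in r -> (0 <= tnth k i - c i < 3)%R.
  move=> /hr /(_ i); set v := tnth (vdiv u h) i => /andP[h1 h2].
  have {}h1 : (tnth k i)%:~R - 1 < v / t by rewrite ltr_pdivlMr.
  have {}h2 : v / t <= (tnth k i)%:~R + 2 by rewrite ler_pdivrMr.
  have c1 : tnth k i - 1 < Num.ceil (v / t).
    by rewrite -(ltr_int R) rmorphB/= (lt_le_trans h1)// ceil_ge.
  have c2 : Num.ceil (v / t) <= tnth k i + 2.
    by rewrite ceil_le_int rmorphD.
  by rewrite /c -/v; apply/andP; split; lia.
pose F (k : d.-tuple int) : d.-tuple 'I_3 := [tuple inord `|tnth k i - c i|%N | i < d].
have uF : uniq (map F r).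
  rewrite map_inj_in_uniq// => k k' kr k'r /(congr1 (fun z => tnth z)) FF.
  apply: eq_from_tnth => i.
  have /(congr1 val) := congr1 (fun z => z i) FF; rewrite !tnth_mktuple /=.
  have := kc k i kr; have := kc k' i k'r.
  have b3 (z : int) : 0 <= z < 3 -> (`|z| < 3)%N by lia.
  move=> z'3 z3; rewrite !inordK ?b3// => zz.
  have {zz} : tnth k i - c i = tnth k' i - c i.
    by move: (tnth k i - c i) (tnth k' i - c i) z3 z'3 zz => z z'; lia.
  exact: addIr.
rewrite -(size_map F) -(card_uniqP uF).
by rewrite (leq_trans (max_card _))// card_tuple card_ord.
Qed.

End cells.

Section truncated_kernel.
Context (R : realType) (d : nat) (U : d.-tuple R -> R).
Hypothesis U_meas : measurable_fun setT U.
Variables (M t a : R) (f : d.-tuple R -> R) (mu : probability (d.-tuple R) R).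
Hypothesis U_bounded : forall x, `|U x| <= M.
Hypothesis U_sym : forall x, U (vopp x) = U x.
Hypothesis t0 : 0 < t.
Hypothesis U_supp : forall x, U x != 0 -> forall j, - t < tnth x j < t.
Hypothesis a0 : 0 < a.
Hypothesis mf : measurable_fun setT f.
Hypothesis f0 : forall x, 0 <= f x.
Hypothesis f_bound : ('N[leb R d]_(+oo)[EFin \o f] <= a^-1%:E)%E.
Hypothesis muE : forall A, measurable A -> mu A = (\int[leb R d]_(x in A) (f x)%:E)%E.
Variable h : d.-tuple R.
Hypothesis h0 : forall j, 0 < tnth h j.

Local Notation rd := (@reflect_dilate R d).

(* Truncating at 1 changes the kernel on a null set only, since [`|U| <= varpi U]
   almost everywhere. *)
Definition ukernel (z : d.-tuple R * d.-tuple R) : R :=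
  Num.min 1 (`|U (rd z.1 h z.2)| / varpi U).

Let vp1 : 1 <= varpi U. Proof. exact: (varpi_ge1 U_meas U_bounded t0 U_supp). Qed.
Let vp0 : 0 < varpi U. Proof. exact: lt_le_trans vp1. Qed.
Let V0 : 0 < vol h. Proof. by apply: prodr_gt0. Qed.

Lemma measurable_rd2 : measurable_fun setT
  (fun z : d.-tuple R * d.-tuple R => rd z.1 h z.2).
Proof.
apply/measurable_fun_tnthP => i.
rewrite (_ : _ \o _ = fun z => (tnth z.1 i - tnth z.2 i) / tnth h i).
  apply: measurable_funM => //; apply: measurable_funB => //.
  - exact: (measurableT_comp (measurable_tnth i) measurable_fst).
  - exact: (measurableT_comp (measurable_tnth i) measurable_snd).
by apply/funext => z /=; rewrite !tnth_mktuple.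
Qed.

Let mU2 : measurable_fun setT
  (fun z : d.-tuple R * d.-tuple R => `|U (rd z.1 h z.2)|).
Proof. by apply: measurableT_comp => //; exact: (measurableT_comp U_meas measurable_rd2). Qed.

Lemma measurable_ukernel : measurable_fun setT ukernel.
Proof. by apply: measurable_minr => //; exact: measurable_funM. Qed.

Lemma ukernel01 z : 0 <= ukernel z <= 1.
Proof. by rewrite /ukernel le_min ler01 ge_min lexx /= divr_ge0// ltW. Qed.

(** Transfers bounds on integrals over the second argument to the first; this is where the symmetry
    of [U] enters. *)
Lemma ukernel_sym u x : ukernel (u, x) = ukernel (x, u).
Proof.
rewrite /ukernel /= -[U (rd u h x)]U_sym; congr (Num.min 1 (`|U _| / _)).
by apply: eq_from_tnth => i; rewrite !tnth_mktuple -mulNr opprB.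
Qed.

Let mUx u : measurable_fun setT (fun x => `|U (rd u h x)|).
Proof. exact: (measurable_section1 mU2 u). Qed.

Let mux u : measurable [set x | varpi U < `|U (rd u h x)|].
Proof. exact: measurable_gt_fun. Qed.

(** Reflection and dilation preserve Lebesgue null sets, and [mu] has a density. *)
Lemma ukernel_null u : mu [set x | varpi U < `|U (rd u h x)|] = 0%E.
Proof.
have mN : measurable [set x | varpi U < `|U x|].
  by apply: measurable_gt_fun => //; exact: measurableT_comp.
have N0 : leb R d [set x | varpi U < `|U x|] = 0%E.
  apply: measure_negligible => //.
  have := varpi_ae U_meas U_bounded t0 U_supp.
  by apply: negligibleS => x /=; rewrite ltNge => /negP.
rewrite muE//; apply: null_set_integral => //.
- by apply: measurable_funTS; exact/measurable_EFinP.
- rewrite (_ : [set x | _] = rd u h @^-1` [set x | varpi U < `|U x|])//.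
  by rewrite measure_reflect_dilate// N0 mule0.
Qed.

Lemma ukernel_ae u : {ae mu, forall x, `|U (rd u h x)| = varpi U * ukernel (u, x)}.
Proof.
exists [set x | varpi U < `|U (rd u h x)|]; split => //; first exact: ukernel_null.
move=> x /=; apply: contra_notP => /negP; rewrite -leNgt => xu.
by rewrite /ukernel min_r ?ler_pdivrMr ?mul1r//= mulrC divfK ?gt_eqF.
Qed.

(** The density is at most [a^-1] almost everywhere, and the integral of [|U|] is at most [varpi U],
    which cancels the normalization. *)
Lemma integral_ukernel_le u : (\int[mu]_x (ukernel (u, x))%:E <= (vol h / a)%:E)%E.
Proof.
have mk := measurable_section1 measurable_ukernel u.
have k0 x : 0 <= ukernel (u, x) by have /andP[] := ukernel01 (u, x).
rewrite (integral_density mf f0 muE mk k0).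
have fae : {ae leb R d, forall x, `|f x| <= a^-1}.
  by apply: Lnorm_pinfty_ae => //; exact: leb_setT_gt0.
apply: (@le_trans _ _ (\int[leb R d]_x ((a * varpi U)^-1 * `|U (rd u h x)|)%:E)%E).
  apply: ae_ge0_le_integral => //.
  - by move=> x _; rewrite lee_fin mulr_ge0.
  - by apply/measurable_EFinP; exact: measurable_funM.
  - by move=> x _; rewrite lee_fin mulr_ge0// invr_ge0 mulr_ge0// ltW.
  - by apply/measurable_EFinP; exact: measurable_funM.
  - apply: filterS fae => x fx _; rewrite lee_fin.
    rewrite (_ : (a * varpi U)^-1 * _ = `|U (rd u h x)| / varpi U * a^-1); last first.
      by field; rewrite !gt_eqF.
    apply: ler_pM => //; first by rewrite /ukernel ge_min lexx orbT.
    by rewrite -[leLHS]ger0_norm.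
under eq_integral do rewrite EFinM.
have mU : measurable_fun setT (fun x => `|U x|) by exact: measurableT_comp.
rewrite ge0_integralZl_EFin//; last 2 first.
- exact/measurable_EFinP.
- by rewrite invr_ge0 mulr_ge0// ltW.
rewrite (integral_reflect_dilate u h0 mU)//.
have := integral_le_varpi U_meas U_bounded t0 U_supp.
rewrite -(@lee_pmul2l _ ((a * varpi U)^-1 * vol h)%:E)//; last first.
  by rewrite lte_fin mulr_gt0// invr_gt0 mulr_gt0.
rewrite EFinM -muleA => /le_trans; apply.
rewrite -EFinM lee_fin le_eqVlt; apply/orP; left; apply/eqP; field.
by rewrite !gt_eqF.
Qed.

Lemma integral_ukernel_cell u : exists k,
  (\int[mu]_x (ukernel (u, x))%:E <= mu (cell_at t h k))%E.
Proof.
(* The kernel lives on a cube of side 2t centred at [u / h]. Cells of side 3t on a lattice of step t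
   always contain such a cube: this [k] puts the centre in the middle third. *)
pose k : d.-tuple int := [tuple Num.ceil (tnth (vdiv u h) i / t) - 1 | i < d].
exists k; have mC := measurable_cell_at t h k.
rewrite -[X in mu X]setIT -integral_indic//.
apply: ge0_le_integral => //.
- by move=> x _; rewrite lee_fin; have /andP[] := ukernel01 (u, x).
- by apply/measurable_EFinP; exact: (measurable_section1 measurable_ukernel u).
- exact/measurable_EFinP.
move=> x _; rewrite lee_fin indicE.
have [->|Un0] := eqVneq (ukernel (u, x)) 0; first by [].
rewrite mem_set; first by have /andP[] := ukernel01 (u, x).
have {Un0} : U (rd u h x) != 0.
  apply: contra_neq Un0 => U0; rewrite /ukernel /= U0 normr0 mul0r.
  by rewrite min_r.
move=> /U_supp hx i; have := hx i; rewrite !tnth_mktuple mulrBl => /andP[x1 x2].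
set v := tnth u i / tnth h i in x1 x2 *.
have c1 : v <= (Num.ceil (v / t))%:~R * t by rewrite -ler_pdivrMr// ceil_ge.
have c2 : ((Num.ceil (v / t))%:~R - 1) * t < v.
  by rewrite -ltr_pdivlMr//; have := ceilB1_lt (v / t); rewrite rmorphB.
rewrite rmorphB/=.
have e1 : ((Num.ceil (v / t))%:~R - 1 - 1) * t = ((Num.ceil (v / t))%:~R - 1) * t - t by ring.
have e2 : ((Num.ceil (v / t))%:~R - 1 + 2) * t = (Num.ceil (v / t))%:~R * t + t by ring.
by rewrite e1 e2; apply/andP; split; lra.
Qed.

Definition ukernel_mean : R := fine (\int[mu]_u \int[mu]_x (ukernel (u, x))%:E)%E.

Let k0 z : 0 <= ukernel z. Proof. by have /andP[] := ukernel01 z. Qed.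

Let psi u := fine (\int[mu]_x (ukernel (u, x))%:E)%E.

Let psiE u : (\int[mu]_x (ukernel (u, x))%:E = (psi u)%:E)%E.
Proof.
rewrite /psi fineK// ge0_fin_numE; last by apply: integral_ge0 => x _; rewrite lee_fin.
by rewrite (le_lt_trans (integral_ukernel_le u))// ltry.
Qed.

Let psi0 u : 0 <= psi u.
Proof. by rewrite -lee_fin -psiE; apply: integral_ge0 => x _; rewrite lee_fin. Qed.

Let mpsi : measurable_fun setT psi.
Proof.
apply: (measurableT_comp (fine_measurable measurableT)).
exact: (measurable_integral_snd mu measurable_ukernel k0).
Qed.

Lemma integral_ukernel : (\int[mu]_u \int[mu]_x (ukernel (u, x))%:E = ukernel_mean%:E)%E.
Proof.
rewrite /ukernel_mean fineK// ge0_fin_numE; last first.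
  by apply: integral_ge0 => u _; apply: integral_ge0 => x _; rewrite lee_fin.
apply: (@le_lt_trans _ _ (vol h / a)%:E); last exact: ltry.
apply: integral_le_cst; [|by move=> u; apply: integral_ge0 => x _; rewrite lee_fin|exact: integral_ukernel_le].
exact: (measurable_integral_snd mu measurable_ukernel k0).
Qed.

Lemma ukernel_mean_ge0 : 0 <= ukernel_mean.
Proof.
rewrite -lee_fin -integral_ukernel; apply: integral_ge0 => u _.
by apply: integral_ge0 => x _; rewrite lee_fin.
Qed.

Lemma J_detE : J_det U f h = varpi U / vol h * ukernel_mean.
Proof.
have inner y : (\int[leb R d]_z (`|U (rd y h z)| * f z)%:E = (varpi U * psi y)%:E)%E.
  rewrite -(integral_density mf f0 muE (mUx y))//.
  transitivity (\int[mu]_z (varpi U * ukernel (y, z))%:E)%E.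
    apply: ge0_ae_eq_integral => //.
    - exact/measurable_EFinP.
    - apply/measurable_EFinP; apply: measurable_funM => //.
      exact: (measurable_section1 measurable_ukernel y).
    - by move=> z _; rewrite lee_fin mulr_ge0// ltW.
    - by have := ukernel_ae y; apply: filterS => z -> _.
  under eq_integral do rewrite EFinM.
  rewrite ge0_integralZl_EFin ?psiE//; last by exact: ltW.
  - by move=> z _; rewrite lee_fin.
  - by apply/measurable_EFinP; exact: (measurable_section1 measurable_ukernel y).
have {}inner y : (\int[leb R d]_z (`|rescaled U h (vsub y z)| * f y * f z)) =
    varpi U / vol h * psi y * f y.
  rewrite /Rintegral.
  transitivity (fine (((vol h)^-1 * f y)%:E * \int[leb R d]_z (`|U (rd y h z)| * f z)%:E)%E).
    congr fine; rewrite -ge0_integralZl_EFin//.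
    - apply: eq_integral => z _; rewrite -EFinM /rescaled normrM ger0_norm ?invr_ge0 ?(ltW V0)//.
      by congr (_%:E); rewrite /reflect_dilate; ring.
    - by move=> z _; rewrite lee_fin mulr_ge0.
    - by apply/measurable_EFinP; exact: measurable_funM.
    - by rewrite mulr_ge0// invr_ge0 ltW.
  by rewrite inner -EFinM /=; ring.
rewrite /J_det; under eq_Rintegral do rewrite inner.
rewrite /Rintegral -(integral_density mf f0 muE (g := fun y => varpi U / vol h * psi y)).
- under eq_integral do rewrite EFinM.
  rewrite ge0_integralZl_EFin//.
  + by under eq_integral do rewrite -psiE; rewrite integral_ukernel.
  + by move=> y _; rewrite lee_fin.
  + exact/measurable_EFinP.
  + by rewrite divr_ge0// ltW.
- exact: measurable_funM.
- by move=> y; rewrite mulr_ge0// divr_ge0// ltW.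
Qed.

Lemma J_empE m (x y : 'I_m -> d.-tuple R) :
  (forall i j, `|U (rd (y i) h (x j))| <= varpi U) ->
  J_emp U x y h = varpi U / (m%:R ^+ 2 * vol h) *
    \sum_(i < m) \sum_(j < m) ukernel (y i, x j).
Proof.
move=> hU; rewrite /J_emp.
rewrite (eq_bigr (fun i => varpi U / vol h * \sum_(j < m) ukernel (y i, x j))).
  by rewrite -mulr_sumr [in RHS]invfM mulrA mulrCA.
move=> i _; rewrite mulr_sumr; apply: eq_bigr => j _.
rewrite /rescaled normrM ger0_norm ?invr_ge0 ?(ltW V0)//.
rewrite /ukernel min_r ?ler_pdivrMr ?mul1r//= /reflect_dilate; field.
by rewrite !gt_eqF.
Qed.

End truncated_kernel.

(** * The good event of one bandwidth *)

Section one_bandwidth.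
Context (R : realType) (d : nat) (U : d.-tuple R -> R).
Hypothesis U_meas : measurable_fun setT U.
Variables (M t a q : R) (m : nat) (f : d.-tuple R -> R) (mu : probability (d.-tuple R) R).
Hypothesis U_bounded : forall x, `|U x| <= M.
Hypothesis U_sym : forall x, U (vopp x) = U x.
Hypothesis t0 : 0 < t.
Hypothesis U_supp : forall x, U x != 0 -> forall j, - t < tnth x j < t.
Hypothesis hq : 1 <= q.
Hypothesis hm : (9 <= m)%N.
Hypothesis aL : 1 <= a * ln m%:R.
Hypothesis a3 : a <= 3^-1.
Hypothesis mf : measurable_fun setT f.
Hypothesis f0 : forall x, 0 <= f x.
Hypothesis f_bound : ('N[leb R d]_(+oo)[EFin \o f] <= a^-1%:E)%E.
Hypothesis muE : forall A, measurable A -> mu A = (\int[leb R d]_(x in A) (f x)%:E)%E.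

Local Notation L := (ln m%:R : R).
Local Notation s := (12 * q + 2).
Local Notation l := (s * L).
Local Notation Tm := (m.-tuple (d.-tuple R)).
Local Notation Q := (pw mu m).

Lemma logm_gt0 : 0 < L.
Proof. by rewrite ln_gt0// ltr1n (leq_trans _ hm). Qed.

Lemma a_gt0 : 0 < a.
Proof.
by rewrite -(pmulr_lgt0 _ logm_gt0) (lt_le_trans ltr01).
Qed.

Lemma logm_ge3 : 3 <= L.
Proof.
have := ler_wpM2r (ltW logm_gt0) a3; have := aL; lra.
Qed.

Let s14 : 14 <= s. Proof. by have := hq; lra. Qed.

Let l42 : 42 <= l.
Proof.
by apply: (@le_trans _ _ (14 * 3)); [lra|apply: ler_pM => //; exact: logm_ge3].
Qed.

Let m0 : 0 < m%:R :> R. Proof. by rewrite ltr0n (leq_trans _ hm). Qed.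

Variable h : d.-tuple R.
Hypothesis h_grid : grid m h.

Lemma grid_gt0 j : 0 < tnth h j.
Proof. by case: h_grid => -[/(_ j)/andP[]]. Qed.

Lemma grid_vol_gt0 : 0 < vol h.
Proof. by apply: prodr_gt0 => j _; exact: grid_gt0. Qed.

Let V0 := grid_vol_gt0.
Local Notation A := (m%:R * vol h).

Let A0 : 0 < A. Proof. exact: mulr_gt0. Qed.

Let A_ge : L <= m%:R * A.
Proof. by case: h_grid => -[_]; rewrite expr2 mulrA. Qed.

Let D := Upsilon m a h * s.
Let w := W_det m a t q f h * A.
Let w_emp (x : Tm) := W_emp a t q (tnth x) h * A.

Let indic_large : \1_(grid_large m) h = (~~ (A < L)%R)%:R :> R.
Proof.
rewrite indicE; congr ((nat_of_bool _)%:R); apply/idP/idP.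
  by move=> /set_mem [_ hs]; apply/negP => AL; apply: hs.
by move=> AL; apply/mem_set; split=> // -[_]; apply/negP.
Qed.

Let indic_small : \1_(grid_small m) h = (A < L)%R%:R :> R.
Proof.
rewrite indicE; congr ((nat_of_bool _)%:R); apply/idP/idP; first by move=> /set_mem [].
by move=> AL; apply/mem_set.
Qed.

Let w_smallE : A < L -> w = A / a /\ forall x, w_emp x = A / a.
Proof.
by move=> AL; split=> [|x]; rewrite /w /w_emp /W_det /W_emp /truncate indic_large
  indic_small AL /= mulr0 add0r mulr1 mulrC.
Qed.

Local Notation p k := (fine (mu (cell_at t h k))).
Let mC k : measurable (cell_at t h k) := measurable_cell_at t h k.

Let pE k : \int[leb R d]_y (\1_(cell t k) (vdiv y h) * f y) = p k.
Proof.
rewrite /Rintegral muE// [in RHS]integral_mkcond; congr fine.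
apply: eq_integral => y _; rewrite /patch indicE.
rewrite (_ : (vdiv y h \in cell t k) = (y \in cell_at t h k)).
  by case: ifP; rewrite ?mul1r ?mul0r.
by apply/idP/idP => /set_mem ?; exact/mem_set.
Qed.

Let w_largeE : ~~ (A < L) ->
  w = Num.max (256 * l) (m%:R * sup (range (fun k => p k))).
Proof.
move=> AL; rewrite /w /W_det /truncate indic_large indic_small AL (negPf AL) /=.
rewrite mulr0 addr0 mulr1 /calW_det.
under [X in range X]eq_fun do rewrite pE.
set X := Num.max _ _; rewrite (_ : _ * X * A = m%:R * X); last first.
  by field; rewrite gt_eqF.
rewrite maxr_pMr ?(ltW m0)//.
by congr (Num.max _ _); field; rewrite gt_eqF.
Qed.

Let w_emp_largeE (x : Tm) : ~~ (A < L) ->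
  w_emp x = Num.max (256 * l) (sup (range (fun k => count_in R (cell_at t h k) x))).
Proof.
move=> AL; rewrite /w_emp /W_emp /truncate indic_large indic_small AL (negPf AL) /=.
rewrite mulr0 addr0 mulr1 /calW_emp mulrAC mulVf ?gt_eqF// mul1r.
by congr (Num.max _ _); ring.
Qed.

Let p01 k : 0 <= p k <= 1.
Proof.
rewrite fine_ge0//= -lee_fin fineK ?fin_num_measure//.
exact: probability_le1.
Qed.

Let sup_p k : p k <= sup (range (fun k => p k)).
Proof.
apply: sup_upper_bound; last by exists k.
split; first by exists (p k), k.
by exists 1 => _ [k' _ <-]; have /andP[] := p01 k'.
Qed.

Let sup_count (x : Tm) k : count_in R (cell_at t h k) x <=
  sup (range (fun k => count_in R (cell_at t h k) x)).
Proof.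
apply: sup_upper_bound; last by exists k.
split; first by exists (count_in R (cell_at t h k) x), k.
exists m%:R => _ [k' _ <-]; rewrite -[m in leRHS]card_ord -sumr_const.
by apply: ler_sum => j _; rewrite indicE lern1 leq_b1.
Qed.

Let w_gt0 : 0 < w.
Proof.
have [AL|AL] := boolP (A < L).
  by rewrite (w_smallE AL).1 divr_gt0// a_gt0.
rewrite (w_largeE AL) lt_max; apply/orP; left.
by apply: mulr_gt0; [rewrite ltr0n|exact: lt_le_trans l42].
Qed.

(** For small bandwidths [W] is not random and the event is empty. Otherwise the upper bound needs
    every cell, while the lower bound needs a single well chosen one. *)
Lemma cell_counts_deviation : exists B : set Tm, [/\ measurable B,
  (Q B <= (m%:R * 3 ^+ d * expR (- (3 * l)) + expR (- l))%:E)%E &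
  forall x, ~ B x -> w_emp x <= 5 / 4 * w /\ w <= 5 * w_emp x].
Proof.
have b0 : 0 <= m%:R * 3 ^+ d * expR (- (3 * l)) + expR (- l).
  by rewrite addr_ge0 ?expR_ge0// !mulr_ge0 ?expR_ge0// exprn_ge0.
have [AL|AL] := boolP (A < L).
  exists set0; split; rewrite ?measure0 ?lee_fin//.
  move=> x _; rewrite (w_smallE AL).2 (w_smallE AL).1.
  have : 0 < A / a by rewrite divr_gt0// a_gt0.
  lra.
have w256 : 256 * l <= w by rewrite w_largeE// le_max lexx.
have l1 : 1 <= l by have := l42; lra.
have [B1 [mB1 QB1 hB1]] : exists B : set Tm, [/\ measurable B,
    (Q B <= (m%:R * 3 ^+ d * expR (- (3 * l)))%:E)%E &
    forall x, ~ B x -> forall k, count_in R (cell_at t h k) x <= 5 / 4 * w].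
  apply: (counts_above (C := cell_at t h)) => //.
  - by move=> u r ur hr; rewrite -natrX; exact: (cell_at_mult t0 ur hr).
  - move=> k; rewrite w_largeE// le_max; apply/orP; right.
    by rewrite ler_wpM2l// ltW.
have [B2 [mB2 QB2 hB2]] : exists B : set Tm, [/\ measurable B,
    (Q B <= (expR (- l))%:E)%E & forall x, ~ B x -> w <= 5 * w_emp x].
  have emp256 x : 256 * l <= w_emp x by rewrite w_emp_largeE// le_max lexx.
  (* When [w] is within a factor 5 of the floor 256 l, the same floor in [w_emp] settles the
     claim. *)
  have [ws|] := leP w (5 * (256 * l)).
    exists set0; split; rewrite ?measure0 ?lee_fin ?expR_ge0//.
    by move=> x _; apply: (le_trans ws); rewrite ler_wpM2l.
  set ps := sup (range (fun k => p k)) => wl.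
  have wE : w = m%:R * ps.
    rewrite w_largeE//; apply: max_r; rewrite leNgt; apply/negP => ml.
    by move: wl; rewrite w_largeE// max_l ?(ltW ml)//; have := l42; lra.
  have ps0 : 0 < ps by rewrite -(pmulr_rgt0 _ m0) -wE.
  (* A cell with more than half of the supremum suffices: off the event its count exceeds w/4 - l,
     which is at least w/5 because w > 1280 l. *)
  have [_ [k _ <-] pk] : exists2 e, range (fun k => p k) e & ps - ps / 2 < e.
    apply: sup_adherent; first by rewrite divr_gt0.
    split; first by exists (p [tuple 0 | _ < d]), [tuple 0 | _ < d].
    by exists 1 => _ [k' _ <-]; have /andP[] := p01 k'.
  exists [set x | count_in R (cell_at t h k) x <= 1 / 2 * (m%:R * p k) - l]; split.
  - by apply: measurable_ge_fun => //; exact: measurable_count_in.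
  - exact: count_below.
  - move=> x /= /negP; rewrite -ltNge => cx.
    have c2 : count_in R (cell_at t h k) x <= w_emp x.
      by rewrite w_emp_largeE// le_max sup_count orbT.
    have pk2 : m%:R * (ps / 2) <= m%:R * p k by rewrite ler_wpM2l ?ltW//; lra.
    rewrite wE in wl *; lra.
exists (B1 `|` B2); split; first exact: measurableU.
- by rewrite EFinD; apply: (le_trans (measureU2 _ _ _)) => //; exact: leeD.
move=> x /not_orP[/hB1 h1 /hB2 h2]; split=> //.
rewrite w_emp_largeE// ge_max; apply/andP; split.
  have := l42; lra.
apply: ge_sup; last by move=> _ [k _ <-].
by exists (count_in R (cell_at t h [tuple 0 | _ < d]) x), [tuple 0 | _ < d].
Qed.

(** One bound for both regimes: the sup norm of [f] yields it for small bandwidths, the mass of a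
    covering cell for large ones. *)
Let ker_le u : (\int[mu]_x (ukernel U h (u, x))%:E <= (w / m%:R)%:E)%E.
Proof.
have [AL|AL] := boolP (A < L).
  apply: (le_trans (integral_ukernel_le U_meas U_bounded t0 U_supp a_gt0 mf f0 f_bound muE grid_gt0 u)).
  rewrite lee_fin (w_smallE AL).1 le_eqVlt; apply/orP; left; apply/eqP; field.
  by rewrite !gt_eqF// a_gt0.
have [k uk] := integral_ukernel_cell U_meas mu U_bounded t0 U_supp h u.
apply: (le_trans uk); rewrite -(fineK (fin_num_measure _ _ (mC k))) lee_fin.
rewrite ler_pdivlMr// mulrC w_largeE// le_max; apply/orP; right.
exact: (ler_wpM2l (ltW m0) (sup_p k)).
Qed.

Let D_small : A <= a ^+ 2 -> D = 17 * l / `|ln A|.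
Proof.
move=> Aa; rewrite /D /Upsilon !indicE memNset; last first.
  by move=> [_]; apply; split=> //; case: h_grid.
by rewrite mem_set; [rewrite mulr0 add0r mulr1; ring|split=> //; case: h_grid].
Qed.

Let D_large : a ^+ 2 < A -> D = 10 * l.
Proof.
move=> aA; rewrite /D /Upsilon !indicE mem_set; last first.
  by split; [case: h_grid|move=> [_] /=; rewrite leNgt aA].
by rewrite memNset; [rewrite mulr0 addr0 mulr1; ring|move=> [_] /=; rewrite leNgt aA].
Qed.

Let a2_le : a ^+ 2 <= 9^-1.
Proof.
rewrite (_ : 9^-1 = 3^-1 ^+ 2 :> R); last by rewrite exprVn; congr (_^-1); ring.
by rewrite ler_sqr ?nnegrE ?(ltW a_gt0)// invr_ge0.
Qed.

Let lnA_bounds : A <= a ^+ 2 -> 0 < - ln A <= L.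
Proof.
move=> Aa; apply/andP; split.
  by rewrite oppr_gt0 ln_lt0// A0/= (le_lt_trans Aa)// (le_lt_trans a2_le)// invf_lt1// ltr1n.
rewrite -lnV ?posrE// ler_ln ?posrE ?invr_gt0//.
rewrite -[leLHS]mul1r ler_pdivrMr// (le_trans _ A_ge)//.
by rewrite (le_trans _ logm_ge3)// ler1n.
Qed.

(** In the logarithmic regime [|ln (m V_h)| <= ln m], so [D >= 17 s]; in the other one
    [D = 10 l]. *)
Lemma Upsilon_lower : 88 <= D.
Proof.
have [Aa|aA] := leP A (a ^+ 2); last first.
  rewrite D_large//; have := l42; lra.
have /andP[y0 yL] := lnA_bounds Aa.
rewrite D_small// ler0_norm; last by rewrite -oppr_ge0 ltW.
rewrite ler_pdivlMr//.
have h1 := ler_wpM2l (_ : 0 <= 88) yL.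
apply: (le_trans (h1 _)) => //.
rewrite mulrA ler_wpM2r ?ltW ?logm_gt0//; have := s14; lra.
Qed.

(** The fraction 3/10 leaves room for the factors 3 and 4 that [M0 * l] receives in
    [statistic_deviation]. *)
Let rowsum_cutoff : exists M0 : R, [/\ 0 < M0, M0 <= 3 / 2 * w + 3 / 10 * D &
  forall u, (Q [set x | (M0 < \sum_(j < m) ukernel U h (u, tnth x j))%R] <= (expR (1 - l))%:E)%E].
Proof.
have l0 : 0 < l by rewrite (lt_le_trans _ l42).
have mk u : measurable_fun setT (fun x => ukernel U h (u, x)).
  exact: (measurable_section1 (measurable_ukernel U_meas h) u).
have tail u lam M0 : 0 <= lam -> w * (expR lam - 1) - lam * M0 <= 1 - l ->
    (Q [set x | (M0 < \sum_(j < m) ukernel U h (u, tnth x j))%R] <= (expR (1 - l))%:E)%E.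
  move=> lam0 hlam; have k01 x : 0 <= ukernel U h (u, x) <= 1.
    exact: (ukernel01 U_meas U_bounded t0 U_supp).
  apply: (le_trans (rowsum_tail m M0 (mk u) k01 (ker_le u) lam0)).
  by rewrite lee_fin ler_expR (_ : m%:R * (w / m%:R) = w)// mulrC divfK ?gt_eqF.
have [Aa|aA] := leP A (a ^+ 2); last first.
  (* Here [D = 10 l], so 3 l is exactly 3/10 D; the tail is taken at [lam = 1/3]. *)
  exists (3 / 2 * w + 3 * l); split.
  - by rewrite addr_gt0// mulr_gt0.
  - by rewrite D_large//; lra.
  - move=> u; apply: (@tail u 3^-1) => //.
    have e : expR (3^-1 : R) <= 3/2.
      have := @expR_le_inv R 3^-1; rewrite (_ : (1 - 3^-1)^-1 = 3/2 :> R); last by field.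
      by apply; rewrite invf_lt1// ltr1n.
    have := ler_wpM2l (ltW w_gt0) e; lra.
have /andP[y0 yL] := lnA_bounds Aa.
have AL : A < L.
  rewrite (le_lt_trans Aa)// (le_lt_trans a2_le)// (lt_le_trans _ logm_ge3)//.
  by rewrite (@lt_trans _ _ 1)// ?ltr1n// invf_lt1// ltr1n.
set y := - ln A in y0 yL.
(* The cutoff makes [lam * M0 = l] for [lam = y / 2], and 2 l / y is below 3/10 D = 51/10 l / y. *)
exists (2 * l / y); split.
- by rewrite divr_gt0// mulr_gt0.
- rewrite D_small// ler0_norm -/y; last by rewrite -oppr_ge0 ltW.
  have ly : 0 < l / y by rewrite divr_gt0.
  have w0 := w_gt0; rewrite -!mulrA; lra.
(* Here [w = A / a] and [expR (y / 2) = A `^ (- 1 / 2)], so that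
   [w * expR (y / 2) <= 1]. *)
- move=> u; apply: (@tail u (y / 2)); first by rewrite ltW// divr_gt0.
  rewrite (_ : y / 2 * (2 * l / y) = l); last by field; rewrite gt_eqF.
  rewrite lerD2r (w_smallE AL).1.
  set E := expR (- y / 2).
  have EX : E * expR (y / 2) = 1 by rewrite -expRD mulNr addNr expR0.
  have Ae : A = E ^+ 2.
    by rewrite expr2 -expRD -splitr /y opprK lnK.
  have ea : E <= a.
    by rewrite -ler_sqr ?nnegrE ?(ltW a_gt0) ?expR_ge0// -Ae.
  rewrite Ae (_ : E ^+ 2 / a * _ = (E * (E * expR (y / 2)) - E ^+ 2) / a); last by ring.
  rewrite EX ler_pdivrMr ?a_gt0//; have := sqr_ge0 E; lra.
Qed.

Definition bandwidth_statistic (x y : Tm) : R :=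
  \sum_(i < m) \sum_(j < m) ukernel U h (tnth y i, tnth x j).

Local Notation j := (m%:R ^+ 2 * ukernel_mean U mu h).

Lemma statistic_deviation : exists B : set (Tm * Tm), [/\ measurable B,
  ((Q \x Q) B <= (4 * expR (- l) + m%:R * expR (1 - l) + m%:R * (m%:R * expR (1 - l)))%:E)%E &
  forall x y, ~ B (x, y) ->
    bandwidth_statistic x y <= 9 / 4 * j + 9 * w * l + D * l /\
    j <= 4 * bandwidth_statistic x y + 8 * w * l + 2 * D * l].
Proof.
have [M0 [M00 M0D tail]] := rowsum_cutoff.
have mN : (0 < m)%N by rewrite (leq_trans _ hm).
have ker_r x : (\int[mu]_u (ukernel U h (u, x))%:E <= (w / m%:R)%:E)%E.
  by under eq_integral do rewrite ukernel_sym//; exact: ker_le.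
have om0 : 0 < w / m%:R by rewrite divr_gt0// w_gt0.
have := decoupled_deviation l mN (measurable_ukernel U_meas h)
  (ukernel01 U_meas U_bounded t0 U_supp h) om0 M00 ker_r
  (integral_ukernel U_meas U_bounded t0 U_supp a_gt0 mf f0 f_bound muE grid_gt0) tail.
move=> [B [mB QB hB]]; exists B; split=> // x y /hB /=.
rewrite -/(bandwidth_statistic x y) (_ : m%:R * (w / m%:R) = w); last first.
  by rewrite mulrC divfK ?gt_eqF.
move=> [S1 S2].
have l0 : 0 <= l by rewrite (le_trans _ l42).
have D88 := Upsilon_lower.
have := ler_wpM2r l0 M0D.
have := w_gt0; have := l42.
set ll := l in l0 S1 S2 *; move=> ll42 w0 Ml.
have wl : 0 <= w * ll by rewrite mulr_ge0// ltW.
have Dl : 88 * ll <= D * ll by rewrite ler_wpM2r.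
(* Above: 9/2 w l + 3 M0 l <= 9 w l + 9/10 D l. Below, after multiplying by 4: 2 w l + 2 + 4 M0 l <=
   8 w l + 6/5 D l + 2, and the 2 is absorbed by the rest of 2 D l. *)
split; lra.
Qed.

(** [J_emp] evaluates [U] itself; off this null event it coincides with the truncated kernel at all
    pairs of sample points. *)
Lemma ukernel_overflow : exists B : set (Tm * Tm), [/\ measurable B, ((Q \x Q) B = 0)%E &
  forall x y, ~ B (x, y) -> forall i k, `|U (reflect_dilate (tnth y i) h (tnth x k))| <= varpi U].
Proof.
pose N u : set (d.-tuple R) := [set x | varpi U < `|U (reflect_dilate u h x)|].
pose B i : set (Tm * Tm) :=
  [set z | exists2 k, k \in enum 'I_m & N (tnth z.2 i) (tnth z.1 k)].
have mBik i k : measurable [set z : Tm * Tm | N (tnth z.2 i) (tnth z.1 k)].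
  apply: measurable_gt_fun => //; apply: measurableT_comp => //; apply: measurableT_comp => //.
  apply: (measurableT_comp (measurable_rd2 h) (measurable_fun_pair
    (measurableT_comp (measurable_tnth i) measurable_snd)
    (measurableT_comp (measurable_tnth k) measurable_fst))).
have mB i : measurable (B i) := measurable_exists_in (enum 'I_m) (mBik i).
have mN u : measurable (N u).
  apply: measurable_gt_fun => //; apply: measurableT_comp => //.
  by apply: measurableT_comp => //; exact: measurable_reflect_dilate.
have null i k : ((Q \x Q) [set z : Tm * Tm | N (tnth z.2 i) (tnth z.1 k)] <= 0%:E)%E.
  apply: product_measure_le_ysection => // y.
  rewrite (pw_coord mu k (mN (tnth y i))).
  by rewrite (ukernel_null U_meas U_bounded t0 U_supp mf muE grid_gt0).
have nulli i : ((Q \x Q) (B i) <= 0%:E)%E.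
  apply: (@le_trans _ _ ((size (enum 'I_m))%:R * 0)%:E); last by rewrite mulr0.
  by apply: (measure_exists_in_le (mBik i)) => k _; exact: null.
exists [set z | exists2 i, i \in enum 'I_m & B i z]; split.
- exact: measurable_exists_in.
- apply/eqP; rewrite eq_le measure_ge0 andbT.
  apply: (@le_trans _ _ ((size (enum 'I_m))%:R * 0)%:E); last by rewrite mulr0.
  by apply: measure_exists_in_le => // i _; exact: nulli.
- move=> x y NB i k; rewrite leNgt; apply/negP => ik; apply: NB.
  by exists i; [rewrite mem_enum|exists k; [rewrite mem_enum|]].
Qed.

Lemma good_event : exists B : set (Tm * Tm), [/\ measurable B,
  ((Q \x Q) B <= ((5 + 2 * expR 1 + 3 ^+ d) * m%:R ^+ 2 * expR (- l))%:E)%E &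
  forall x y, ~ B (x, y) ->
    U_emp a t q U (tnth x) (tnth y) h <= 2 * U_det m a t q U f h /\
    U_det m a t q U f h <= 9 * U_emp a t q U (tnth x) (tnth y) h].
Proof.
have [B1 [mB1 QB1 hB1]] := statistic_deviation.
have [B2 [mB2 QB2 hB2]] := cell_counts_deviation.
have [B3 [mB3 QB3 hB3]] := ukernel_overflow.
have mB2' : measurable [set z : Tm * Tm | B2 z.1].
  by rewrite -[X in measurable X]setTI; exact: measurable_fst.
have l0 : 0 <= l by rewrite (le_trans _ l42).
exists (B1 `|` [set z | B2 z.1] `|` B3); split.
- by apply: measurableU => //; exact: measurableU.
- apply: (le_trans (measureU2 _ (measurableU _ _ mB1 mB2') mB3)).
  rewrite [X in (_ + X)%E]QB3 adde0.
  apply: (le_trans (measureU2 _ mB1 mB2')).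
  apply: (le_trans (leeD QB1 (_ : _ <= (m%:R * 3 ^+ d * expR (- (3 * l)) + expR (- l))%:E)%E)).
    by rewrite [leLHS]product_measure_fst.
  rewrite -EFinD lee_fin expRD.
  have E3 : expR (- (3 * l)) <= expR (- l) by rewrite ler_expR; lra.
  (* All powers of [m] are raised to the second. The five plain exponentials give 5, the terms with
     [m] and [m ^+ 2] times e give 2e, the cells give 3^d. *)
  set E := expR (- l) in E3 *.
  have E0 : 0 <= E by exact: expR_ge0.
  have e0 : 0 <= expR 1 * E by rewrite mulr_ge0// expR_ge0.
  have m1 : 1 <= m%:R :> R by rewrite ler1n (leq_trans _ hm).
  have m2 : 1 <= m%:R ^+ 2 :> R by rewrite exprn_ege1.
  have mm : m%:R <= m%:R ^+ 2 :> R by rewrite expr2 ler_peMr// ltW.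
  have d0 : 0 <= 3 ^+ d :> R by rewrite exprn_ge0.
  have h1 := ler_wpM2r E0 m2.
  have h2 := ler_wpM2r e0 mm.
  have h3 : m%:R * 3 ^+ d * expR (- (3 * l)) <= m%:R ^+ 2 * 3 ^+ d * E.
    by apply: ler_pM => //; rewrite ?mulr_ge0 ?expR_ge0 ?(ltW m0)// ler_wpM2r.
  lra.
- move=> x y /not_orP[/not_orP[/hB1[S1 S2] /= /hB2[w1 w2]] /hB3 hU].
  have vp0 : 0 < varpi U.
    exact: lt_le_trans (varpi_ge1 U_meas U_bounded t0 U_supp).
  have mN : (0 < m)%N by rewrite (leq_trans _ hm).
  have K0 : 0 < varpi U / (m%:R ^+ 2 * vol h) by rewrite divr_gt0// mulr_gt0// exprn_gt0.
  have det : U_det m a t q U f h = varpi U / (m%:R ^+ 2 * vol h) *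
      nmaj l D w (m%:R ^+ 2 * ukernel_mean U mu h).
    rewrite /U_det majorantE//; congr (_ * nmaj _ _ _ _).
    rewrite (J_detE U_meas U_bounded t0 U_supp a_gt0 mf f0 f_bound muE grid_gt0).
    by field; rewrite !gt_eqF.
  have emp : U_emp a t q U (tnth x) (tnth y) h = varpi U / (m%:R ^+ 2 * vol h) *
      nmaj l D (w_emp x) (bandwidth_statistic x y).
    rewrite /U_emp majorantE//; congr (_ * nmaj _ _ _ _).
    rewrite (J_empE U_meas U_bounded t0 U_supp grid_gt0 hU) mulrC mulKf//.
    by rewrite gt_eqF.
  have D88 := Upsilon_lower.
  have w0 := ltW w_gt0.
  have we0 : 0 <= w_emp x by lra.
  have j0 : 0 <= m%:R ^+ 2 * ukernel_mean U mu h.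
    rewrite mulr_ge0 ?exprn_ge0 ?(ltW m0)//.
    exact: (ukernel_mean_ge0 U_meas U_bounded t0 U_supp a_gt0 mf f0 f_bound muE grid_gt0).
  have S0 : 0 <= bandwidth_statistic x y.
    apply: sumr_ge0 => i _; apply: sumr_ge0 => k _.
    by have /andP[] := ukernel01 U_meas U_bounded t0 U_supp h (tnth y i, tnth x k).
  rewrite det emp; split; rewrite [leRHS]mulrCA ler_pM2l//.
  + by apply: nmaj_upper => //; rewrite we0.
  + by apply: nmaj_lower => //; rewrite w0.
Qed.

Let logm_le : L <= m%:R.
Proof. by rewrite -[leRHS]lnK ?posrE//; have := expR_ge1Dx L; lra. Qed.

Lemma Upsilon_upper : D <= 17 * l.
Proof.
have l0 : 0 <= l by rewrite (le_trans _ l42).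
have [Aa|aA] := leP A (a ^+ 2); last by rewrite D_large//; lra.
have /andP[y0 _] := lnA_bounds Aa.
rewrite D_small// ler0_norm; last by rewrite -oppr_ge0 ltW.
rewrite ler_pdivrMr// ler_peMr//; first by rewrite mulr_ge0.
rewrite lerNr -ler_expR lnK ?posrE// (le_trans Aa)// (le_trans a2_le)//.
rewrite expRN lef_pV2 ?posrE ?expR_gt0//.
(* The crude bound e <= 4 is enough: m V_h <= 1/9 then forces [|ln (m V_h)| >= 1]. *)
have e2 := @expR_le_inv R (1 / 2) (ltac:(lra)).
have e1 : expR 1 = expR (1 / 2) * expR (1 / 2) :> R.
  by rewrite -expRD; congr expR; field.
have {}e2 : expR (1 / 2) <= 2 :> R.
  by apply: (le_trans e2); rewrite (_ : 1 - 1 / 2 = 2^-1) ?invrK//; field.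
have h0 := expR_ge0 (1 / 2 : R).
have := ler_pM h0 h0 e2 e2; rewrite -e1; lra.
Qed.

(** On the grid both L / m and L / (m^2 V_h) are at most 1. The roots are removed by sqrt x <= 1 +
    x, whence the leading 2. *)
Lemma majorant_bound W J cW G : 0 <= W <= cW * m%:R ^+ 2 -> 0 <= J <= G * m%:R ^+ 2 ->
  0 <= majorant m a q U h W J <= (2 + 16 * s * varpi U * cW * G + 16 * s * varpi U * G
    + 147 * s * varpi U * cW + 17 * s ^+ 2 * varpi U) * m%:R ^+ 4.
Proof.
move=> /andP[W0 Wc] /andP[J0 JG].
have vp0 : 0 < varpi U by exact: lt_le_trans (varpi_ge1 U_meas U_bounded t0 U_supp).
have L0 := logm_gt0.
have s0 : 0 < s by rewrite (lt_le_trans _ s14).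
have cW0 : 0 <= cW by rewrite -(pmulr_lge0 _ (exprn_gt0 2 m0)) (le_trans W0).
have G0 : 0 <= G by rewrite -(pmulr_lge0 _ (exprn_gt0 2 m0)) (le_trans J0).
have m1 : 1 <= m%:R :> R by rewrite ler1n (leq_trans _ hm).
have Lm : 0 <= L / m%:R <= 1.
  by rewrite divr_ge0 ?(ltW L0) ?(ltW m0)//= ler_pdivrMr// mul1r.
have mV0 : 0 < m%:R ^+ 2 * vol h by rewrite mulr_gt0// exprn_gt0.
have LV : 0 <= L / (m%:R ^+ 2 * vol h) <= 1.
  rewrite divr_ge0 ?(ltW L0) ?(ltW mV0)//= ler_pdivrMr// mul1r.
  by rewrite expr2 -mulrA.
have D0 : 0 <= D by rewrite (le_trans _ Upsilon_lower).
have sv : 0 <= s * varpi U by rewrite mulr_ge0// ltW.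
have root (x : R) : 0 <= x -> Num.sqrt x <= 1 + x.
  move=> x0; rewrite -[leRHS]ger0_norm; last by rewrite addr_ge0.
  rewrite -sqrtr_sqr ler_sqrt ?sqr_ge0//; have := sqr_ge0 x; lra.
have m24 : m%:R ^+ 2 <= m%:R ^+ 4 :> R by rewrite ler_weXn2l.
have m4 : 1 <= m%:R ^+ 4 :> R by rewrite exprn_ege1.
set b1 := L / m%:R in Lm *; set b2 := L / (m%:R ^+ 2 * vol h) in LV *.
have /andP[b10 b11] := Lm; have /andP[b20 b21] := LV.
have mono (x y b : R) : 0 <= x -> x <= y -> 0 <= b <= 1 -> 0 <= x * b <= y.
  move=> x0 xy /andP[c0 c1]; by rewrite mulr_ge0//= (le_trans _ xy)// ler_piMr.
have T1 : 0 <= 16 * s * varpi U * W * J * L / m%:R <= 16 * s * varpi U * cW * G * m%:R ^+ 4.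
  rewrite -mulrA; apply: mono => //.
    by rewrite !mulr_ge0// ltW.
  rewrite (_ : 16 * s * varpi U * W * J = 16 * (s * varpi U) * (W * J)); last by ring.
  rewrite (_ : 16 * s * varpi U * cW * G * m%:R ^+ 4 =
    16 * (s * varpi U) * ((cW * m%:R ^+ 2) * (G * m%:R ^+ 2))); last by ring.
  have c0 : 0 <= 16 * (s * varpi U) by rewrite mulr_ge0.
  exact: (ler_wpM2l c0 (ler_pM W0 J0 Wc JG)).
have T2 : 0 <= 16 * s * varpi U * J * L / (m%:R ^+ 2 * vol h) <= 16 * s * varpi U * G * m%:R ^+ 4.
  rewrite -mulrA; apply: mono => //.
    by rewrite !mulr_ge0// ltW.
  rewrite (_ : 16 * s * varpi U * G * m%:R ^+ 4 =
    16 * s * varpi U * (G * m%:R ^+ 4)); last by rewrite -!mulrA.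
  have c0 : 0 <= 16 * s * varpi U by rewrite -mulrA mulr_ge0.
  exact: (ler_wpM2l c0 (le_trans JG (ler_wpM2l G0 m24))).
have T3 : 0 <= 147 * s * varpi U * W * L / m%:R <= 147 * s * varpi U * cW * m%:R ^+ 4.
  rewrite -mulrA; apply: mono => //.
    by rewrite !mulr_ge0// ltW.
  rewrite (_ : 147 * s * varpi U * cW * m%:R ^+ 4 =
    147 * s * varpi U * (cW * m%:R ^+ 4)); last by rewrite -!mulrA.
  have c0 : 0 <= 147 * s * varpi U by rewrite -mulrA mulr_ge0.
  exact: (ler_wpM2l c0 (le_trans Wc (ler_wpM2l cW0 m24))).
have T4 : 0 <= Upsilon m a h * s ^+ 2 * varpi U * L / (m%:R ^+ 2 * vol h)
    <= 17 * s ^+ 2 * varpi U * m%:R ^+ 4.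
  rewrite -mulrA (_ : Upsilon m a h * s ^+ 2 * varpi U = D * (s * varpi U)); last first.
    by rewrite /D; ring.
  apply: mono => //; first by rewrite mulr_ge0.
  rewrite (_ : 17 * s ^+ 2 * varpi U * m%:R ^+ 4 = 17 * (s * m%:R ^+ 4) * (s * varpi U)); last by ring.
  rewrite ler_wpM2r// (le_trans Upsilon_upper)// ler_wpM2l// ler_wpM2l ?(ltW s0)//.
  by rewrite (le_trans logm_le)// -[leLHS]expr1 ler_weXn2l.
rewrite /majorant.
have /andP[a1 c1] := T1; have /andP[a2 c2] := T2; have /andP[a3' c3] := T3; have /andP[a4 c4] := T4.
rewrite !addr_ge0 ?sqrtr_ge0//=.
have r1 := root _ a1; have r2 := root _ a2.
have sum_le (M4 k1 k2 k3 k4 x1 x2 x3 x4 : R) : 1 <= M4 -> x1 <= 1 + k1 * M4 ->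
    x2 <= 1 + k2 * M4 -> x3 <= k3 * M4 -> x4 <= k4 * M4 ->
    x1 + x2 + x3 + x4 <= (2 + k1 + k2 + k3 + k4) * M4 by move=> *; lra.
by apply: sum_le => //; [exact: le_trans r1 (lerD _ c1)|exact: le_trans r2 (lerD _ c2)].
Qed.

(** For small bandwidths [a^-1 <= L <= m]; for large ones [A >= L >= 1], so that dividing by [A]
    does not increase the value. *)
Let W_bound v z : (A < L -> v = A / a) ->
  (~~ (A < L) -> v = Num.max (256 * l) z /\ 0 <= z <= m%:R) ->
  0 <= v / A <= (256 * s + 1) * m%:R ^+ 2.
Proof.
have L0 := logm_gt0.
have m1 : 1 <= m%:R :> R by rewrite ler1n (leq_trans _ hm).
have s0 : 0 < s by rewrite (lt_le_trans _ s14).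
have l0 : 0 <= l by rewrite (le_trans _ l42).
have m12 : m%:R <= m%:R ^+ 2 :> R by rewrite expr2 ler_peMr// ltW.
have [AL + _|AL _] := boolP (A < L).
  move=> ->//; rewrite mulrAC divff ?gt_eqF// mul1r invr_ge0 (ltW a_gt0)/=.
  apply: (@le_trans _ _ L); first by rewrite -[leLHS]mul1r ler_pdivrMr ?a_gt0// mulrC.
  apply: (le_trans logm_le); apply: (le_trans m12).
  by rewrite ler_peMl ?sqr_ge0//; lra.
move=> /(_ isT)[-> /andP[z0 zm]].
rewrite divr_ge0 ?le_max ?z0 ?orbT ?(ltW A0)//= ler_pdivrMr//.
have A3 : 1 <= A by rewrite -leNgt in AL; rewrite (le_trans _ AL)// (le_trans _ logm_ge3)// ler1n.
have sm : 0 <= s * m%:R ^+ 2 by rewrite mulr_ge0 ?sqr_ge0// ltW.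
have X0 : 0 <= (256 * s + 1) * m%:R ^+ 2 by lra.
apply: (@le_trans _ _ ((256 * s + 1) * m%:R ^+ 2)); last first.
  by move: ((256 * s + 1) * m%:R ^+ 2) X0 => X X0; rewrite ler_peMr.
have sL : s * L <= s * m%:R ^+ 2.
  rewrite ler_wpM2l ?(ltW s0)//; exact: le_trans logm_le m12.
by rewrite ge_max; apply/andP; split; lra.
Qed.

(** The sum [M + varpi U] serves both majorants: [J_det] is at most [varpi U / vol h], while [J_emp]
    is at most [M / vol h] at every sample point, including those of the null event. *)
Let bnd := (2 + 16 * s * varpi U * (256 * s + 1) * (M + varpi U) + 16 * s * varpi U * (M + varpi U)
    + 147 * s * varpi U * (256 * s + 1) + 17 * s ^+ 2 * varpi U) * m%:R ^+ 4.

Let V_inv : (vol h)^-1 <= m%:R ^+ 2.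
Proof.
rewrite -[leLHS]mul1r ler_pdivrMr//; case: h_grid => -[_ LV] _.
by rewrite (le_trans _ LV)// (le_trans _ logm_ge3)// ler1n.
Qed.

Lemma U_det_bound : 0 <= U_det m a t q U f h <= bnd.
Proof.
have vp0 : 0 < varpi U by exact: lt_le_trans (varpi_ge1 U_meas U_bounded t0 U_supp).
have M0 : 0 <= M by apply: le_trans (U_bounded [tuple 0 | _ < d]).
apply: majorant_bound.
  rewrite (_ : W_det m a t q f h = w / A); last by rewrite /w mulfK// gt_eqF.
  apply: (W_bound (z := m%:R * sup (range (fun k => p k)))).
    by move=> AL; rewrite (w_smallE AL).1.
  move=> AL; rewrite w_largeE//; split=> //.
  rewrite mulr_ge0 ?(ltW m0)//=.
    rewrite ler_piMr ?(ltW m0)//; apply: ge_sup.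
      by exists (p [tuple 0 | _ < d]), [tuple 0 | _ < d].
    by move=> _ [k _ <-]; have /andP[] := p01 k.
  have /andP[p0 _] := p01 [tuple 0 | _ < d].
  exact: le_trans p0 (sup_p _).
have km := ukernel_mean_ge0 U_meas U_bounded t0 U_supp a_gt0 mf f0 f_bound muE grid_gt0.
have km1 : ukernel_mean U mu h <= 1.
  rewrite -lee_fin -(integral_ukernel U_meas U_bounded t0 U_supp a_gt0 mf f0 f_bound muE grid_gt0).
  have mk := measurable_ukernel U_meas h.
  have k0 z : 0 <= ukernel U h z by have /andP[] := ukernel01 U_meas U_bounded t0 U_supp h z.
  apply: integral_le_cst.
  - exact: (measurable_integral_snd mu mk k0).
  - by move=> u; apply: integral_ge0 => x _; rewrite lee_fin.
  - move=> u; apply: integral_le_cst.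
    + by apply/measurable_EFinP; exact: (measurable_section1 mk u).
    + by move=> x; rewrite lee_fin.
    + by move=> x; rewrite lee_fin; have /andP[] := ukernel01 U_meas U_bounded t0 U_supp h (u, x).
rewrite (J_detE U_meas U_bounded t0 U_supp a_gt0 mf f0 f_bound muE grid_gt0).
rewrite mulr_ge0 ?divr_ge0 ?(ltW vp0) ?(ltW V0)//=.
rewrite -[leRHS]mulr1; apply: ler_pM => //; first by rewrite divr_ge0 ?(ltW vp0) ?(ltW V0).
by apply: ler_pM => //; rewrite ?invr_ge0 ?(ltW vp0) ?(ltW V0)// lerDr.
Qed.

Lemma U_emp_bound (x y : Tm) : 0 <= U_emp a t q U (tnth x) (tnth y) h <= bnd.
Proof.
have vp0 : 0 < varpi U by exact: lt_le_trans (varpi_ge1 U_meas U_bounded t0 U_supp).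
have M0 : 0 <= M by apply: le_trans (U_bounded [tuple 0 | _ < d]).
apply: majorant_bound.
  rewrite (_ : W_emp a t q (tnth x) h = w_emp x / A); last by rewrite /w_emp mulfK// gt_eqF.
  apply: (W_bound (z := sup (range (fun k => count_in R (cell_at t h k) x)))).
    by move=> AL; rewrite (w_smallE AL).2.
  move=> AL; rewrite w_emp_largeE//; split=> //; apply/andP; split.
    by apply: le_trans (sup_count x [tuple 0 | _ < d]); apply: sumr_ge0.
  apply: ge_sup; first by exists (count_in R (cell_at t h [tuple 0 | _ < d]) x), [tuple 0 | _ < d].
  move=> _ [k _ <-]; rewrite -[m in leRHS]card_ord -sumr_const.
  by apply: ler_sum => i _; rewrite indicE lern1 leq_b1.
rewrite /J_emp mulr_ge0 ?invr_ge0 ?sqr_ge0//=; last first.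
  by apply: sumr_ge0 => i _; apply: sumr_ge0.
rewrite ler_pdivrMl ?exprn_gt0//.
apply: (@le_trans _ _ (\sum_(i < m) \sum_(k < m) (M + varpi U) * m%:R ^+ 2)); last first.
  move: ((M + varpi U) * m%:R ^+ 2) => c.
  rewrite !sumr_const !card_ord -[c *+ m]mulr_natl -[X in X <= _]mulr_natl.
  by rewrite mulrA -expr2.
apply: ler_sum => i _; apply: ler_sum => k _.
rewrite /rescaled normrM ger0_norm ?invr_ge0 ?(ltW V0)// mulrC.
apply: ler_pM => //; first by rewrite invr_ge0 ltW.
by rewrite (le_trans (U_bounded _))// lerDl ltW.
Qed.

End one_bandwidth.

(** * Expectation of the supremum over the grid *)

Section rough_integral.
Context d0 (Omega : measurableType d0) (R : realType) (P : probability Omega R).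

(* No measurability of [f] is required: the integral is a supremum over simple
   functions below the integrand. *)
Lemma ge0_integral_le (mu : {measure set Omega -> \bar R}) (f g : Omega -> \bar R) :
  (forall x, 0 <= f x)%E -> (forall x, f x <= g x)%E ->
  (\int[mu]_x f x <= \int[mu]_x g x)%E.
Proof.
move=> f0 fg; have g0 x : (0 <= g x)%E by exact: le_trans (f0 x) (fg x).
rewrite !ge0_integralTE//; apply: le_ereal_sup => _ [h hf <-].
by exists h => // x; exact: le_trans (hf x) (fg x).
Qed.

Lemma expectation_le_event (F : Omega -> R) (A : set Omega) (c : R) :
  measurable A -> 0 <= c -> (forall w, 0 <= F w <= c) -> (forall w, ~ A w -> F w = 0) ->
  ('E_P[F] <= c%:E * P A)%E.
Proof.
move=> mA c0 Fc FA; rewrite unlock.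
apply: (@le_trans _ _ (\int[P]_w (c%:E * (\1_A w)%:E))%E).
  apply: ge0_integral_le => w; have /andP[F0 F1] := Fc w; first by rewrite lee_fin.
  rewrite -EFinM lee_fin indicE; have [wA|wA] := boolP (w \in A); first by rewrite mulr1.
  by rewrite mulr0 FA// => /mem_set; exact/negP.
rewrite ge0_integralZl//; last by apply/measurable_EFinP; exact: measurable_indic.
by rewrite integral_indic// setIT.
Qed.

End rough_integral.

Section sup_pos_pow_bounds.
Context (R : realType) (d m : nat) (q : R).
Hypothesis q0 : 0 < q.
Implicit Types F : d.-tuple R -> R.

Lemma sup_pos_pow_le F c : 0 <= c -> (forall h, grid m h -> F h <= c) ->
  0 <= sup_pos_pow m q F <= c `^ q.
Proof.
move=> c0 Fc; rewrite /sup_pos_pow; set S := [set _ | _ in _].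
have Sc x : S x -> 0 <= x <= c `^ q.
  move=> [h gh <-]; rewrite powR_ge0/= ge0_ler_powR ?nnegrE ?(ltW q0)//.
    by rewrite le_max lexx orbT.
  by rewrite ge_max c0 Fc.
(* An empty grid gives the default value 0 of [sup]. *)
have [->|S0] := eqVneq S set0; first by rewrite sup0 lexx powR_ge0.
have /set0P[x Sx] := S0; have ubS : ubound S (c `^ q) by move=> y /Sc/andP[].
apply/andP; split; last by apply: ge_sup => //; exists x.
have /andP[x0 _] := Sc _ Sx; apply: (le_trans x0); apply: ub_le_sup => //.
by exists (c `^ q).
Qed.

Lemma sup_pos_pow_eq0 F : (forall h, grid m h -> F h <= 0) -> sup_pos_pow m q F = 0.
Proof.
move=> F0; have := sup_pos_pow_le (lexx 0) F0.
by rewrite powR0 ?gt_eqF// -eq_le => /eqP.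
Qed.

End sup_pos_pow_bounds.

(** * Cardinality of the grid *)

Section grid_list.
Context (R : realType) (d m : nat).
Hypothesis m1 : (1 <= m)%N.
Hypothesis d0 : (0 < d)%N.

Lemma grid_enum : exists s : seq (d.-tuple R),
  (forall h, grid m h -> h \in s) /\ (size s)%:R <= 2 ^+ d * d`!%:R * m%:R :> R.
Proof.
have L0 : 0 <= ln m%:R :> R by rewrite ln_ge0// ler1n.
have fl0 : 0 <= Num.floor (ln m%:R : R) by rewrite floor_ge0.
pose N := absz (2 * Num.floor (ln m%:R : R)).
have NL : N%:R <= 2 * ln m%:R :> R.
  rewrite /N natr_absz ger0_norm ?mulr_ge0// intrM ler_wpM2l//; exact: floor_le.
(* Indices in ['I_N] start at 0, the exponents of the grid at 1. *)
pose e (k : d.-tuple 'I_N) : d.-tuple R := [tuple expR (- (tnth k j).+1%:R) | j < d].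
exists [seq e k | k <- enum {: d.-tuple 'I_N}]; split=> [h [_ hk]|].
  have {}hk j : exists k : 'I_N, tnth h j = expR (- k.+1%:R).
    have [k [k1 kN ->]] := hk j.
    have kN' : (k.-1 < N)%N by rewrite prednK// -lez_nat /N gez0_abs// mulr_ge0.
    by exists (Ordinal kN'); rewrite /= prednK.
  have [k kE] := choice hk; apply/mapP; exists [tuple k j | j < d]; first by rewrite mem_enum.
  by apply: eq_from_tnth => j; rewrite !tnth_mktuple.
rewrite size_map -cardE card_tuple card_ord natrX.
apply: (@le_trans _ _ ((2 * ln m%:R) ^+ d)); first by rewrite lerXn2r ?nnegrE ?mulr_ge0.
rewrite exprMn -mulrA ler_wpM2l ?exprn_ge0// mulrC -ler_pdivrMr ?ltr0n ?fact_gt0//.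
(* A single term of the exponential series: L^d / d! <= e^L = m. *)
have := @expR_ge1Dxn _ (ln m%:R : R) d.-1 L0; rewrite prednK// lnK ?posrE ?ltr0n//; lra.
Qed.

End grid_list.

Lemma rate_le (R : realType) (d m : nat) (q C D : R) : 1 <= q -> (9 <= m)%N -> 3 <= ln m%:R :> R ->
  0 <= C -> 0 <= D ->
  (C * m%:R ^+ 4) `^ q * (D * m%:R * (m%:R ^+ 2 * expR (- ((12 * q + 2) * ln m%:R)))) <=
  C `^ q * D * (2 * ln m%:R) `^ (d%:R / 2) * m%:R `^ (- (2 * q)).
Proof.
move=> q1 m9 L3 C0 D0.
have m0 : 0 < m%:R :> R by rewrite ltr0n (leq_trans _ m9).
rewrite powRM ?exprn_ge0 ?ler0n//.
rewrite [leLHS](_ : _ = C `^ q * D * ((m%:R ^+ 4) `^ q * (m%:R ^+ 3 *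
    expR (- ((12 * q + 2) * ln m%:R)))) :> R); last by ring.
rewrite -[leRHS]mulrA ler_wpM2l ?mulr_ge0 ?powR_ge0//.
have L1 : 1 <= (2 * ln m%:R) `^ (d%:R / 2) :> R.
  rewrite -[leLHS](powRr0 (2 * ln m%:R)) ler_powR//; lra.
apply: (@le_trans _ _ (m%:R `^ (- (2 * q)))); last by rewrite ler_peMl// powR_ge0.
rewrite -!powR_mulrn ?ler0n// -powRrM /powR !gt_eqF// -!expRD ler_expR.
nra.
Qed.

Theorem theorem7 (R : realType) (d : nat) (hd : (1 <= d)%N)
    (U : d.-tuple R -> R)
    (U_meas : measurable_fun setT U)
    (U_bounded : exists M : R, forall x, `|U x| <= M)
    (U_sym : forall x, U (vopp x) = U x)
    (q : R) (hq : 1 <= q) :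
  exists B1 B2 : R,
    forall (t : R) (ht : 0 < t)
      (U_supp : forall x, U x != 0 -> forall j, - t < tnth x j < t)
      (alpha : nat -> R)
      (alpha_mono : nonincreasing_seq alpha)
      (alpha_lim : alpha @ \oo --> 0)
      (m : nat) (hm : (9 <= m)%N)
      (alpha_lower : 1 <= alpha m * ln m%:R)
      (alpha_upper : alpha m <= 3^-1)
      (f : d.-tuple R -> R) (f_dens : prob_density f)
      (f_bound : ('N[leb R d]_(+oo)[EFin \o f] <= (alpha m)^-1%:E)%E)
      (d0 : measure_display) (Omega : measurableType d0)
      (P : probability Omega R)
      (X Y : 'I_m -> {RV P >-> d.-tuple R})
      (X_dens : forall i, has_density (X i) f)
      (Y_dens : forall i, has_density (Y i) f)
      (XY_indep : mutually_independent (two_samples X Y)),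
    let U_hat w h := U_emp (alpha m) t q U (fun i => X i w) (fun i => Y i w) h in
    let U_star h := U_det m (alpha m) t q U f h in
    ('E_P[fun w => sup_pos_pow m q (fun h => (U_hat w h - 2 * U_star h)%R)]
       <= (B1 * (2 * ln m%:R) `^ (d%:R / 2) * m%:R `^ (- (2 * q)))%:E)%E /\
    ('E_P[fun w => sup_pos_pow m q (fun h => (U_star h - 9 * U_hat w h)%R)]
       <= (B2 * (2 * ln m%:R) `^ (d%:R / 2) * m%:R `^ (- (2 * q)))%:E)%E.
Proof.
have [M UM] := U_bounded.
have M0 : 0 <= M by apply: le_trans (UM [tuple 0 | _ < d]).
pose s : R := 12 * q + 2.
pose C : R := 2 + 16 * s * varpi U * (256 * s + 1) * (M + varpi U) + 16 * s * varpi U * (M + varpi U)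
    + 147 * s * varpi U * (256 * s + 1) + 17 * s ^+ 2 * varpi U.
pose D : R := 2 ^+ d * d`!%:R * (5 + 2 * expR 1 + 3 ^+ d).
exists (C `^ q * D), (C `^ q * D).
move=> t t0 U_supp alpha _ _ m hm aL a3 f f_dens f_bound d0 Omega P X Y Xf Yf XYind U_hat U_star.
have [mf f0 _] := f_dens.
have m0 : (0 < m)%N by exact: leq_trans hm.
(* All observations have density [f], so the law of any one of them can serve as [mu]. *)
pose mu := distribution P (X (Ordinal m0)).
have muE A : measurable A -> mu A = (\int[leb R d]_(x in A) (f x)%:E)%E by exact: Xf.
have Xmu i A : measurable A -> P (X i @^-1` A) = mu A.
  by move=> mA; rewrite muE//; exact: Xf.
have Ymu i A : measurable A -> P (Y i @^-1` A) = mu A.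
  by move=> mA; rewrite muE//; exact: Yf.
have L3 := logm_ge3 hm aL a3.
pose rate := (5 + 2 * expR 1 + 3 ^+ d) * m%:R ^+ 2 * expR (- (s * ln m%:R)) : R.
have rate0 : 0 <= rate.
  by rewrite !mulr_ge0 ?expR_ge0 ?exprn_ge0// !addr_ge0 ?mulr_ge0 ?expR_ge0 ?exprn_ge0.
have B_ex h : exists B : set (m.-tuple (d.-tuple R) * m.-tuple (d.-tuple R)),
    [/\ measurable B, ((pw mu m \x pw mu m) B <= rate%:E)%E &
    grid m h -> forall x y, ~ B (x, y) ->
    U_emp (alpha m) t q U (tnth x) (tnth y) h <= 2 * U_det m (alpha m) t q U f h /\
    U_det m (alpha m) t q U f h <= 9 * U_emp (alpha m) t q U (tnth x) (tnth y) h].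
  (* Off the grid the empty event is taken, so that [choice] applies to all [h] at once. *)
  have [gh|gh] := pselect (grid m h); last by exists set0; split; rewrite ?measure0.
  have [B [mB QB hB]] := good_event U_meas UM U_sym t0 U_supp hq hm aL a3 mf f0 f_bound muE gh.
  by exists B; split.
have [B hB] := choice B_ex.
have [hs [hs_grid hs_size]] := grid_enum R m0 hd.
pose Z := sample2 X Y.
pose Bad := [set w | exists2 h, h \in hs & (Z @^-1` B h) w].
have mZB h : measurable (Z @^-1` B h).
  have [mB _ _] := hB h; rewrite -[X in measurable X]setTI.
  exact: measurable_sample2.
have mBad : measurable Bad by exact: measurable_exists_in.
have PBad : (P Bad <= ((size hs)%:R * rate)%:E)%E.
  apply: measure_exists_in_le => // h _; have [mB QB _] := hB h.
  by rewrite /Z (law_sample2 Xmu Ymu XYind).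
have tX w : tnth (sample X w) = (fun i => X i w) by apply/funext => i; rewrite tnth_mktuple.
have tY w : tnth (sample Y w) = (fun i => Y i w) by apply/funext => i; rewrite tnth_mktuple.
have good w h : ~ Bad w -> grid m h -> U_hat w h <= 2 * U_star h /\ U_star h <= 9 * U_hat w h.
  move=> nB gh; rewrite /U_hat -tX -tY; have [_ _ /(_ gh)] := hB h; apply=> Bw.
  by apply: nB; exists h; [exact: hs_grid|].
have star_bnd h : grid m h -> 0 <= U_star h <= C * m%:R ^+ 4.
  exact: (U_det_bound U_meas UM t0 U_supp hq hm aL a3 mf f0 f_bound muE).
have hat_bnd w h : grid m h -> 0 <= U_hat w h <= C * m%:R ^+ 4.
  move=> gh; rewrite /U_hat -tX -tY.
  exact: (U_emp_bound U_meas f UM t0 U_supp hq hm aL a3 gh).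
have C0 : 0 <= C.
  have v0 : 0 <= varpi U by rewrite (le_trans _ (varpi_ge1 U_meas UM t0 U_supp)).
  have s0 : 0 <= s by rewrite /s; lra.
  rewrite /C; move: (varpi U) v0 (s) s0 => v v0 r r0.
  have rv := mulr_ge0 r0 v0; have Mv := addr_ge0 M0 v0.
  have rvr := mulr_ge0 rv r0; have rvM := mulr_ge0 rv Mv; have rvMr := mulr_ge0 rvM r0.
  lra.
have Cm0 : 0 <= C * m%:R ^+ 4 by rewrite mulr_ge0// exprn_ge0.
have q0 : 0 < q by exact: lt_le_trans hq.
suff bound (F : Omega -> d.-tuple R -> R) :
    (forall w h, grid m h -> F w h <= C * m%:R ^+ 4) ->
    (forall w h, ~ Bad w -> grid m h -> F w h <= 0) ->
    ('E_P[fun w => sup_pos_pow m q (F w)]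
       <= (C `^ q * D * (2 * ln m%:R) `^ (d%:R / 2) * m%:R `^ (- (2 * q)))%:E)%E.
  split; apply: bound => [w h gh|w h nB gh].
  - by have /andP[_ ?] := hat_bnd w _ gh; have /andP[? _] := star_bnd _ gh; lra.
  - by have [? _] := good _ _ nB gh; lra.
  - by have /andP[? _] := hat_bnd w _ gh; have /andP[_ ?] := star_bnd _ gh; lra.
  - by have [_ ?] := good _ _ nB gh; lra.
move=> FC F0.
apply: (@le_trans _ _ (((C * m%:R ^+ 4) `^ q)%:E * P Bad)%E).
  apply: expectation_le_event => //; first exact: powR_ge0.
    by move=> w; exact: (sup_pos_pow_le q0 Cm0 (FC w)).
  by move=> w nB; apply: sup_pos_pow_eq0 => // h; exact: F0.
apply: (@le_trans _ _ (((C * m%:R ^+ 4) `^ q)%:E * ((size hs)%:R * rate)%:E)%E).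
  by apply: lee_wpmul2l => //; rewrite lee_fin powR_ge0.
rewrite -EFinM lee_fin; apply: le_trans (rate_le d hq hm L3 C0 _); last first.
  by rewrite !mulr_ge0 ?exprn_ge0// !addr_ge0 ?exprn_ge0// mulr_ge0 ?expR_ge0.
rewrite ler_wpM2l ?powR_ge0//; apply: (le_trans (ler_wpM2r rate0 hs_size)).
by rewrite /rate /D /s le_eqVlt; apply/orP; left; apply/eqP; ring.
Qed.
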